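(* Let $k$ be a perfect field of characteristic $p>0$, let $(\widetilde X,\widetilde F_X)$ be a Frobenius lifting of a $k$-scheme $X$, and let $\sigma$ be a Frobenius splitting on $X$. Let $\widetilde X(\sigma)$ be the canonical lifting of $X$ over $W_2(k)$ induced by $\sigma$. Then there is a canonical isomorphism $\widetilde X(\sigma)\simeq\widetilde X$ of liftings of $X$ (depending on $\widetilde F_X$ and $\sigma$).
   Context: A Frobenius lifting of $X$ is a flat $W_2(k)$-scheme $\widetilde X$ lifting $X$ together with a morphism $\widetilde F_X\colon\widetilde X\to\widetilde X$ lifting the absolute Frobenius $F_X$. A Frobenius splitting ($F$-splitting) on $X$ is an $\mathcal O_X$-linear map $\sigma\colon F_{X*}\mathcal O_X\to\mathcal O_X$ splitting $F_X^*\colon\mathcal O_X\to F_{X*}\mathcal O_X$. The canonical lifting $\widetilde X(\sigma)$ is the flat $W_2(k)$-scheme with the same underlying topological space as $X$ and structure sheaf $\mathcal O_{\widetilde X(\sigma)}=W_2(\mathcal O_X)/\{(0,f):\sigma(f)=0\}$, where $W_2(\mathcal O_X)$ is the sheaf of Witt vectors of length two (its elements written as pairs $(f_0,f_1)$); the identification $\widetilde X(\sigma)\otimes_{W_2(k)}k\simeq X$ is induced by $(f_0,f_1)\mapsto f_0$. An isomorphism of liftings of $X$ is an isomorphism of $W_2(k)$-schemes inducing the identity on $X$. *)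

(* Defs.v *)
(* MathComp with the classical and topological layers of MathComp-Analysis.
   Rings of sections may be zero (over the empty set), hence [comPzRingType]. *)
From HB Require Import structures.
From mathcomp Require Import all_boot all_algebra generic_quotient ring.
From mathcomp Require Import boolp classical_sets functions topology.
Set Implicit Arguments. Unset Strict Implicit. Unset Printing Implicit Defensive.
Import GRing.Theory Num.Theory.
Local Open Scope classical_set_scope.
Local Open Scope ring_scope.
Local Open Scope quotient_scope.

(* ((x + y)^p - x^p - y^p) / p for p prime, with integral coefficients. *)
Definition witt_carry (p : nat) (A : comPzRingType) (x y : A) : A :=
  \sum_(1 <= i < p) x ^+ (p - i) * y ^+ i *+ ('C(p, i) %/ p).

Section Carry.
Variables (p : nat) (p_pr : prime p).

Lemma witt_carryE (A : comPzRingType) (x y : A) :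
  (x + y) ^+ p = x ^+ p + y ^+ p + witt_carry p x y *+ p.
Proof.
have p0 := prime_gt0 p_pr.
rewrite exprDn -(big_mkord predT (fun i => x ^+ (p - i) * y ^+ i *+ 'C(p, i))).
rewrite big_nat_recr //= big_ltn // subn0 subnn bin0 binn !expr0 mulr1 mul1r !mulr1n.
rewrite addrAC; congr (_ + _).
rewrite /witt_carry -sumrMnl; apply: eq_big_nat => i /andP[i0 ip].
by rewrite -mulrnA divnK // prime_dvd_bin // i0 ip.
Qed.

Lemma witt_carryC (A : comPzRingType) (x y : A) :
  witt_carry p x y = witt_carry p y x.
Proof.
rewrite /witt_carry big_nat_rev /=; apply: eq_big_nat => i /andP[i0 ip].
by rewrite add1n subSS mulrC subKn 1?ltnW // bin_sub 1?ltnW.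
Qed.

Lemma witt_carry0 (A : comPzRingType) (x : A) : witt_carry p x 0 = 0.
Proof.
rewrite /witt_carry big_nat big1 // => i /andP[i0 ip].
by rewrite expr0n gtn_eqF // mulr0 mul0rn.
Qed.

Lemma witt_carryM (A : comPzRingType) (a x y : A) :
  witt_carry p (a * x) (a * y) = a ^+ p * witt_carry p x y.
Proof.
rewrite /witt_carry mulr_sumr; apply: eq_big_nat => i /andP[i0 ip].
by rewrite !exprMn mulrACA -exprD subnK 1?ltnW // mulrnAr.
Qed.

Lemma witt_carry_morph (A B : comPzRingType) (f : {rmorphism A -> B}) x y :
  f (witt_carry p x y) = witt_carry p (f x) (f y).
Proof.
by rewrite rmorph_sum; apply: eq_bigr => i _; rewrite rmorphMn rmorphM !rmorphXn.
Qed.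

Lemma poly_ev (S A : comNzRingType) (f : {rmorphism S -> A}) (x : A) :
  exists g : {rmorphism {poly S} -> A}, g 'X = x /\ forall c, g c%:P = f c.
Proof.
have cfx : commr_rmorph f x by move=> ?; apply: mulrC.
exists (horner_morph cfx); split; first exact: horner_morphX.
by move=> c; apply: horner_morphC.
Qed.

Lemma witt_carry_cocycle (A : comPzRingType) (x y z : A) :
  witt_carry p x y + witt_carry p (x + y) z =
  witt_carry p y z + witt_carry p x (y + z).
Proof.
have [A0|A1] := eqVneq (1 : A) 0.
  by rewrite -[LHS]mul1r -[RHS]mul1r A0 !mul0r.
pose B : comNzRingType := HB.pack (GRing.ComPzRing.sort A)
  (GRing.PzSemiRing_isNonZero.Build (GRing.ComPzRing.sort A) A1).
have [f [fX _]] := poly_ev (intr : {rmorphism int -> B}) (x : B).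
have [g [gX gC]] := poly_ev f (y : B).
have [h [hX hC]] := poly_ev g (z : B).
pose X : {poly {poly {poly int}}} := 'X%:P%:P.
pose Y : {poly {poly {poly int}}} := 'X%:P.
pose Z : {poly {poly {poly int}}} := 'X.
have hx : h X = x by rewrite hC gC.
have hy : h Y = y by rewrite hC.
have hz : h Z = z by [].
suff E : witt_carry p X Y + witt_carry p (X + Y) Z =
         witt_carry p Y Z + witt_carry p X (Y + Z).
  have := congr1 h E; rewrite !rmorphD /=.
  by rewrite !witt_carry_morph !rmorphD hx hy hz.
have tf (S : nzRingType) : (forall a : S, a *+ p = 0 -> a = 0) ->
    forall P : {poly S}, P *+ p = 0 -> P = 0.
  move=> hS P P0; apply/polyP => i; rewrite coef0; apply: hS.
  by rewrite -coefMn P0 coef0.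
have tfZ (a : int) : a *+ p = 0 -> a = 0.
  by move/eqP; rewrite mulrn_eq0 gtn_eqF ?prime_gt0 // => /eqP.
apply/subr0_eq/(tf _ (tf _ (tf _ tfZ))).
have carry_p (a b : {poly {poly {poly int}}}) :
    witt_carry p a b *+ p = (a + b) ^+ p - a ^+ p - b ^+ p.
  rewrite witt_carryE; move: (_ *+ p) (a ^+ p) (b ^+ p) => u v w; ring.
rewrite mulrnBl !mulrnDl !carry_p (addrA X Y Z).
move: (_ ^+ p) (_ ^+ p) (_ ^+ p) (_ ^+ p) (_ ^+ p) (_ ^+ p) => a b c d e e1; ring.
Qed.
End Carry.

(* Witt vectors of length two for the prime p.  The ghost components of (a0, a1)
   are a0 and a0^p + p a1; they give the addition and multiplication below. The
   primality proof is a parameter because it is needed for the ring axioms. *)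
Record witt2 (p : nat) (p_pr : prime p) (A : Type) := Witt2 { w0 : A; w1 : A }.

Lemma witt2_eq (p : nat) (p_pr : prime p) (A : Type) (a b : witt2 p_pr A) :
  w0 a = w0 b -> w1 a = w1 b -> a = b.
Proof. by case: a b => [? ?] [? ?] /= -> ->. Qed.

Section Witt2Choice.
Variables (p : nat) (p_pr : prime p) (A : choiceType).
Definition witt2_pair (a : witt2 p_pr A) := (w0 a, w1 a).
Lemma witt2_pairK :
  cancel witt2_pair (fun x => Witt2 p_pr x.1 x.2).
Proof. by case. Qed.
HB.instance Definition _ := Choice.copy (witt2 p_pr A) (can_type witt2_pairK).
End Witt2Choice.

Section Witt2Ring.
Variables (p : nat) (p_pr : prime p) (A : comPzRingType).
Local Notation W := (witt2 p_pr A).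
Local Notation carry := (@witt_carry p A).

Definition witt2_zero : W := Witt2 p_pr 0 0.
Definition witt2_one : W := Witt2 p_pr 1 0.
Definition witt2_opp (a : W) : W :=
  Witt2 p_pr (- w0 a) (- w1 a + carry (w0 a) (- w0 a)).
Definition witt2_add (a b : W) : W :=
  Witt2 p_pr (w0 a + w0 b) (w1 a + w1 b - carry (w0 a) (w0 b)).
Definition witt2_mul (a b : W) : W :=
  Witt2 p_pr (w0 a * w0 b)
    (w0 a ^+ p * w1 b + w0 b ^+ p * w1 a + (w1 a * w1 b) *+ p).

Lemma witt2_addC : commutative witt2_add.
Proof.
by move=> [a0 a1] [b0 b1]; apply: witt2_eq; rewrite /= ?[a0 + _]addrC // witt_carryC [a1 + _]addrC.
Qed.

Lemma witt2_addA : associative witt2_add.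
Proof.
move=> [a0 a1] [b0 b1] [c0 c1]; apply: witt2_eq; rewrite /= ?addrA //.
have := witt_carry_cocycle p_pr a0 b0 c0.
move/(canRL (addrK _)) => ->; ring.
Qed.

Lemma witt2_add0 : left_id witt2_zero witt2_add.
Proof.
by move=> [a0 a1]; apply: witt2_eq; rewrite /= ?add0r // witt_carryC witt_carry0 subr0.
Qed.

Lemma witt2_addN : left_inverse witt2_zero witt2_opp witt2_add.
Proof.
move=> [a0 a1]; apply: witt2_eq; rewrite /= ?addNr // [carry (- a0) _]witt_carryC; ring.
Qed.

HB.instance Definition _ := GRing.isZmodule.Build W
  witt2_addA witt2_addC witt2_add0 witt2_addN.

Lemma witt2_mulC : commutative witt2_mul.
Proof. by move=> [a0 a1] [b0 b1]; apply: witt2_eq; rewrite /=; ring. Qed.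

Lemma witt2_mulA : associative witt2_mul.
Proof.
by move=> [a0 a1] [b0 b1] [c0 c1]; apply: witt2_eq; rewrite /= ?exprMn; ring.
Qed.

Lemma witt2_mul1 : left_id witt2_one witt2_mul.
Proof.
move=> [a0 a1]; apply: witt2_eq; rewrite /= ?expr1n; ring.
Qed.

Lemma witt2_mulDl : left_distributive witt2_mul witt2_add.
Proof.
move=> [a0 a1] [b0 b1] [c0 c1]; apply: witt2_eq; rewrite /=; first by ring.
rewrite ![_ * c0]mulrC witt_carryM (witt_carryE p_pr); ring.
Qed.

HB.instance Definition _ := GRing.Zmodule_isComPzRing.Build W
  witt2_mulA witt2_mulC witt2_mul1 witt2_mulDl.
End Witt2Ring.

Section Witt2Map.
Variables (p : nat) (p_pr : prime p) (A B : comPzRingType).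
Variable f : {rmorphism A -> B}.
Definition witt2_map (a : witt2 p_pr A) : witt2 p_pr B :=
  Witt2 p_pr (f (w0 a)) (f (w1 a)).

Lemma witt2_map_zmod : zmod_morphism witt2_map.
Proof.
move=> [a0 a1] [b0 b1]; apply: witt2_eq; rewrite /= ?rmorphB //.
by rewrite !(rmorphD, rmorphN) /= !(witt_carry_morph, rmorphN).
Qed.
Lemma witt2_map_monoid : monoid_morphism witt2_map.
Proof.
split=> [|[a0 a1] [b0 b1]]; apply: witt2_eq; rewrite /= ?rmorph1 ?rmorph0 ?rmorphM //.
by rewrite !rmorphD rmorphMn !rmorphM !rmorphXn.
Qed.
HB.instance Definition _ := GRing.isZmodMorphism.Build _ _ witt2_map witt2_map_zmod.
HB.instance Definition _ :=
  GRing.isMonoidMorphism.Build _ _ witt2_map witt2_map_monoid.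
End Witt2Map.
Arguments witt2_map {p} p_pr {A B} f a.

Section Witt2Proj.
Variables (p : nat) (p_pr : prime p) (A : comPzRingType).
Definition witt2_proj (a : witt2 p_pr A) : A := w0 a.
Lemma witt2_proj_zmod : zmod_morphism witt2_proj.
Proof. by move=> [a0 a1] [b0 b1]. Qed.
Lemma witt2_proj_monoid : monoid_morphism witt2_proj.
Proof. by split=> [|[a0 a1] [b0 b1]]. Qed.
HB.instance Definition _ := GRing.isZmodMorphism.Build _ _ witt2_proj witt2_proj_zmod.
HB.instance Definition _ :=
  GRing.isMonoidMorphism.Build _ _ witt2_proj witt2_proj_monoid.
End Witt2Proj.

(* Commutative ring axioms up to an equivalence relation; the quotient is a ring.
   Used for stalks (germs) and for quotients by ideals. *)
Record setoid_ring := SetoidRing {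
  sr_car : Type;
  sr_eq : sr_car -> sr_car -> Prop;
  sr_zero : sr_car;
  sr_one : sr_car;
  sr_opp : sr_car -> sr_car;
  sr_add : sr_car -> sr_car -> sr_car;
  sr_mul : sr_car -> sr_car -> sr_car;
  sr_refl : forall a, sr_eq a a;
  sr_sym : forall a b, sr_eq a b -> sr_eq b a;
  sr_trans : forall a b c, sr_eq a b -> sr_eq b c -> sr_eq a c;
  sr_opp_eq : forall a a', sr_eq a a' -> sr_eq (sr_opp a) (sr_opp a');
  sr_add_eq : forall a a' b b',
    sr_eq a a' -> sr_eq b b' -> sr_eq (sr_add a b) (sr_add a' b');
  sr_mul_eq : forall a a' b b',
    sr_eq a a' -> sr_eq b b' -> sr_eq (sr_mul a b) (sr_mul a' b');
  sr_addA : forall a b c, sr_eq (sr_add a (sr_add b c)) (sr_add (sr_add a b) c);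
  sr_addC : forall a b, sr_eq (sr_add a b) (sr_add b a);
  sr_add0 : forall a, sr_eq (sr_add sr_zero a) a;
  sr_addN : forall a, sr_eq (sr_add (sr_opp a) a) sr_zero;
  sr_mulA : forall a b c, sr_eq (sr_mul a (sr_mul b c)) (sr_mul (sr_mul a b) c);
  sr_mulC : forall a b, sr_eq (sr_mul a b) (sr_mul b a);
  sr_mul1 : forall a, sr_eq (sr_mul sr_one a) a;
  sr_mulD : forall a b c,
    sr_eq (sr_mul (sr_add a b) c) (sr_add (sr_mul a c) (sr_mul b c)) }.

Section SetoidRingQuotient.
Variable R : setoid_ring.
Definition sr_rel : rel {classic sr_car R} := fun a b => `[< sr_eq a b >].
Lemma sr_rel_refl : reflexive sr_rel.
Proof. by move=> a; apply/asboolP/sr_refl. Qed.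
Lemma sr_rel_sym : symmetric sr_rel.
Proof. by move=> a b; apply/asboolP/asboolP; apply: sr_sym. Qed.
Lemma sr_rel_trans : transitive sr_rel.
Proof. by move=> b a c /asboolP h /asboolP h'; apply/asboolP/(sr_trans h h'). Qed.
Canonical sr_equiv := EquivRel sr_rel sr_rel_refl sr_rel_sym sr_rel_trans.

Definition sr_quot := {eq_quot sr_equiv}.
HB.instance Definition _ := Choice.on sr_quot.
Definition sr_pi (a : sr_car R) : sr_quot := \pi_({eq_quot sr_equiv}) a.
Definition sr_repr (q : sr_quot) : sr_car R := repr q.

Lemma sr_reprK q : sr_pi (sr_repr q) = q.
Proof. exact: reprK. Qed.
Lemma sr_piP a b : sr_pi a = sr_pi b <-> sr_eq a b.
Proof. by split=> [/eqmodP/asboolP|h] //; apply/eqmodP/asboolP. Qed.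
Lemma sr_pi_repr a : sr_eq (sr_repr (sr_pi a)) a.
Proof. by apply/sr_piP; rewrite sr_reprK. Qed.

Let zero := sr_pi (sr_zero R).
Let one := sr_pi (sr_one R).
Let opp q := sr_pi (sr_opp (sr_repr q)).
Let add q r := sr_pi (sr_add (sr_repr q) (sr_repr r)).
Let mul q r := sr_pi (sr_mul (sr_repr q) (sr_repr r)).
Let oppE a : opp (sr_pi a) = sr_pi (sr_opp a).
Proof. exact/sr_piP/sr_opp_eq/sr_pi_repr. Qed.
Let addE a b : add (sr_pi a) (sr_pi b) = sr_pi (sr_add a b).
Proof. by apply/sr_piP/sr_add_eq; apply: sr_pi_repr. Qed.
Let mulE a b : mul (sr_pi a) (sr_pi b) = sr_pi (sr_mul a b).
Proof. by apply/sr_piP/sr_mul_eq; apply: sr_pi_repr. Qed.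

Let addA : associative add.
Proof.
move=> a b c; rewrite -(sr_reprK a) -(sr_reprK b) -(sr_reprK c) !addE.
exact/sr_piP/sr_addA.
Qed.
Let addC : commutative add.
Proof.
by move=> a b; rewrite -(sr_reprK a) -(sr_reprK b) !addE; apply/sr_piP/sr_addC.
Qed.
Let add0 : left_id zero add.
Proof. by move=> a; rewrite -(sr_reprK a) addE; apply/sr_piP/sr_add0. Qed.
Let addN : left_inverse zero opp add.
Proof. by move=> a; rewrite -(sr_reprK a) oppE addE; apply/sr_piP/sr_addN. Qed.
HB.instance Definition _ := GRing.isZmodule.Build sr_quot addA addC add0 addN.
Let mulA : associative mul.
Proof.
move=> a b c; rewrite -(sr_reprK a) -(sr_reprK b) -(sr_reprK c) !mulE.
exact/sr_piP/sr_mulA.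
Qed.
Let mulC : commutative mul.
Proof.
by move=> a b; rewrite -(sr_reprK a) -(sr_reprK b) !mulE; apply/sr_piP/sr_mulC.
Qed.
Let mul1 : left_id one mul.
Proof. by move=> a; rewrite -(sr_reprK a) mulE; apply/sr_piP/sr_mul1. Qed.
Let mulD : left_distributive mul add.
Proof.
move=> a b c; rewrite -(sr_reprK a) -(sr_reprK b) -(sr_reprK c) addE !mulE addE.
exact/sr_piP/sr_mulD.
Qed.
HB.instance Definition _ :=
  GRing.Zmodule_isComPzRing.Build sr_quot mulA mulC mul1 mulD.

Lemma sr_pi0 : sr_pi (sr_zero R) = 0. Proof. by []. Qed.
Lemma sr_pi1 : sr_pi (sr_one R) = 1. Proof. by []. Qed.
Lemma sr_piD a b : sr_pi (sr_add a b) = sr_pi a + sr_pi b.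
Proof. by rewrite -addE. Qed.
Lemma sr_piN a : sr_pi (sr_opp a) = - sr_pi a.
Proof. by rewrite -oppE. Qed.
Lemma sr_piM a b : sr_pi (sr_mul a b) = sr_pi a * sr_pi b.
Proof. by rewrite -mulE. Qed.
End SetoidRingQuotient.

Definition is_unit (A : comPzRingType) (a : A) : Prop := exists b, a * b = 1.

Identity Coercion set_pred : set >-> Funclass.

Record ideal (A : comPzRingType) := Ideal {
  ideal_set :> set A;
  ideal0 : ideal_set 0;
  idealD : forall a b, ideal_set a -> ideal_set b -> ideal_set (a + b);
  idealM : forall a b, ideal_set b -> ideal_set (a * b) }.

Section QuotientRing.
Variables (A : comPzRingType) (I : ideal A).

Lemma idealN a : I a -> I (- a).
Proof. by rewrite -mulN1r; apply: idealM. Qed.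
Lemma quotient_subproof_eq a b : a = b -> I (a - b).
Proof. by move=> ->; rewrite subrr; apply: ideal0. Qed.

Definition quotient_setoid : setoid_ring.
Proof.
refine (@SetoidRing A (fun a b => I (a - b)) 0 1 -%R +%R *%R
  _ _ _ _ _ _ _ _ _ _ _ _ _ _).
- by move=> a; apply: quotient_subproof_eq.
- by move=> a b ?; rewrite -opprB; apply: idealN.
- by move=> a b c ? ?; rewrite -(subrKA b); apply: idealD.
- by move=> a b ?; rewrite -opprD; apply: idealN.
- by move=> a a' b b' ? ?; rewrite opprD addrACA; apply: idealD.
- move=> a a' b b' ? ?.
  have -> : a * b - a' * b' = b * (a - a') + a' * (b - b') by ring.
  by apply: idealD; apply: idealM.
- by move=> a b c; apply: quotient_subproof_eq; rewrite addrA.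
- by move=> a b; apply: quotient_subproof_eq; rewrite addrC.
- by move=> a; apply: quotient_subproof_eq; rewrite add0r.
- by move=> a; apply: quotient_subproof_eq; rewrite addNr.
- by move=> a b c; apply: quotient_subproof_eq; rewrite mulrA.
- by move=> a b; apply: quotient_subproof_eq; rewrite mulrC.
- by move=> a; apply: quotient_subproof_eq; rewrite mul1r.
- by move=> a b c; apply: quotient_subproof_eq; rewrite mulrDl.
Defined.

Definition quotient_ring : comPzRingType := sr_quot quotient_setoid.
Definition quotient_pi (a : A) : quotient_ring := @sr_pi quotient_setoid a.
Lemma quotient_pi_zmod : zmod_morphism quotient_pi.
Proof.
move=> a b; rewrite /quotient_pi.
by rewrite -(sr_piN (b : sr_car quotient_setoid)) -sr_piD.
Qed.
Lemma quotient_pi_monoid : monoid_morphism quotient_pi.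
Proof. by split=> // a b; rewrite /quotient_pi -sr_piM. Qed.
HB.instance Definition _ :=
  GRing.isZmodMorphism.Build _ _ quotient_pi quotient_pi_zmod.
HB.instance Definition _ :=
  GRing.isMonoidMorphism.Build _ _ quotient_pi quotient_pi_monoid.
Lemma quotient_piP a b : quotient_pi a = quotient_pi b <-> I (a - b).
Proof. exact: (@sr_piP quotient_setoid a b). Qed.
Lemma quotient_pi_surj (q : quotient_ring) : exists a, q = quotient_pi a.
Proof. by exists (sr_repr q); rewrite /quotient_pi sr_reprK. Qed.

Section Lift.
Variables (B : comPzRingType) (f : {rmorphism A -> B}).
Hypothesis f0 : forall a, I a -> f a = 0.
Definition quotient_lift (q : quotient_ring) : B := f (sr_repr q).
Lemma quotient_liftE a : quotient_lift (quotient_pi a) = f a.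
Proof.
apply/subr0_eq; rewrite /quotient_lift -rmorphB; apply: f0.
exact: (@sr_pi_repr quotient_setoid a).
Qed.
Lemma quotient_lift_zmod : zmod_morphism quotient_lift.
Proof.
move=> q r; have [a ->] := quotient_pi_surj q; have [b ->] := quotient_pi_surj r.
by rewrite -rmorphB !quotient_liftE rmorphB.
Qed.
Lemma quotient_lift_monoid : monoid_morphism quotient_lift.
Proof.
split=> [|q r]; first by rewrite -(rmorph1 quotient_pi) quotient_liftE rmorph1.
have [a ->] := quotient_pi_surj q; have [b ->] := quotient_pi_surj r.
by rewrite -rmorphM !quotient_liftE rmorphM.
Qed.
End Lift.
End QuotientRing.

Definition quotient_desc (A B : comPzRingType) (I : ideal A)
    (f : {rmorphism A -> B}) (f0 : forall a, I a -> f a = 0) :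
    {rmorphism quotient_ring I -> B} :=
  HB.pack (quotient_lift f)
    (GRing.isZmodMorphism.Build _ _ _ (quotient_lift_zmod f0))
    (GRing.isMonoidMorphism.Build _ _ _ (quotient_lift_monoid f0)).

Lemma quotient_descE (A B : comPzRingType) (I : ideal A)
    (f : {rmorphism A -> B}) (f0 : forall a, I a -> f a = 0) a :
  quotient_desc f0 (quotient_pi I a) = f a.
Proof. exact: quotient_liftE. Qed.

Record opens (T : topologicalType) := Opens {
  open_set :> set T;
  open_setP : open open_set }.

Section Opens.
Variable T : topologicalType.
Definition opensT : opens T := Opens openT.
Definition opensI (U V : opens T) : opens T :=
  Opens (openI (open_setP U) (open_setP V)).
Lemma sub_opensT (U : opens T) : U `<=` opensT.
Proof. by []. Qed.
Lemma opensI_subl (U V : opens T) : opensI U V `<=` U.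
Proof. exact: subIsetl. Qed.
Lemma opensI_subr (U V : opens T) : opensI U V `<=` V.
Proof. exact: subIsetr. Qed.
End Opens.

Definition preim_opens (S T : topologicalType) (f : S -> T) (cf : continuous f)
    (V : opens T) : opens S :=
  Opens (open_comp (fun x _ => cf x) (open_setP V)).

(* A topological space with a sheaf of commutative rings. Sections are defined on
   open sets only; restriction maps are indexed by (proof-irrelevant) inclusions. *)
Record ringed_space := RingedSpace {
  rs_top :> topologicalType;
  sec : opens rs_top -> comPzRingType;
  res : forall U V : opens rs_top, V `<=` U -> {rmorphism sec U -> sec V};
  res_id : forall (U : opens rs_top) (h : U `<=` U) s, res h s = s;
  res_comp : forall (U V W : opens rs_top) (h : V `<=` U) (h' : W `<=` V) (h'' : W `<=` U) s,
    res h' (res h s) = res h'' s;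
  sec_separated : forall (I : Type) (U : opens rs_top) (V : I -> opens rs_top)
      (VU : forall i, V i `<=` U),
    U `<=` \bigcup_i V i ->
    forall s t : sec U, (forall i, res (VU i) s = res (VU i) t) -> s = t;
  sec_glue : forall (I : Type) (U : opens rs_top) (V : I -> opens rs_top)
      (VU : forall i, V i `<=` U),
    U `<=` \bigcup_i V i ->
    forall s : forall i, sec (V i),
    (forall i j (W : opens _) (Wi : W `<=` V i) (Wj : W `<=` V j),
       res Wi (s i) = res Wj (s j)) ->
    exists t : sec U, forall i, res (VU i) t = s i }.

Arguments sec_separated {r I U V} VU _ {s t} _.

Section Stalk.
Variables (X : ringed_space) (x : X).

Record germ_rep := GermRep {
  gr_nbhd : opens X;
  gr_in : gr_nbhd x;
  gr_sec : sec gr_nbhd }.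

Definition germ_eq (a b : germ_rep) : Prop :=
  exists (W : opens X) (Wa : W `<=` gr_nbhd a) (Wb : W `<=` gr_nbhd b),
    W x /\ res Wa (gr_sec a) = res Wb (gr_sec b).

Definition germ_op (op : forall A : comPzRingType, A -> A -> A)
    (a b : germ_rep) : germ_rep :=
  @GermRep (opensI (gr_nbhd a) (gr_nbhd b)) (conj (gr_in a) (gr_in b))
    (op _ (res (@opensI_subl _ (gr_nbhd a) (gr_nbhd b)) (gr_sec a))
          (res (@opensI_subr _ (gr_nbhd a) (gr_nbhd b)) (gr_sec b))).

Lemma res_irr (U V : opens X) (h h' : V `<=` U) s : res h s = res h' s.
Proof. by rewrite (Prop_irrelevance h h'). Qed.

Lemma res_res (U V W : opens X) (h : V `<=` U) (h' : W `<=` V) s :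
  res h' (res h s) = res (subset_trans h' h) s.
Proof. exact: res_comp. Qed.

Lemma germ_op_eq (op : forall A : comPzRingType, A -> A -> A) a a' b b' :
  (forall (A B : comPzRingType) (f : {rmorphism A -> B}) u v,
     f (op A u v) = op B (f u) (f v)) ->
  germ_eq a a' -> germ_eq b b' -> germ_eq (germ_op op a b) (germ_op op a' b').
Proof.
move=> opf [W [Wa [Wa' [Wx Wr]]]] [Z [Za [Za' [Zx Zr]]]].
have WZ1 := @opensI_subl _ W Z.
have WZ2 := @opensI_subr _ W Z.
have Z1 : opensI W Z `<=` gr_nbhd (germ_op op a b) := setISS Wa Za.
have Z2 : opensI W Z `<=` gr_nbhd (germ_op op a' b') := setISS Wa' Za'.
exists (opensI W Z), Z1, Z2; split=> //=.
rewrite !opf !res_res; congr (op _ _ _).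
  have := congr1 (res WZ1) Wr; rewrite !res_res.
  by rewrite (res_irr _ (subset_trans WZ1 Wa)) => ->; apply: res_irr.
have := congr1 (res WZ2) Zr; rewrite !res_res.
by rewrite (res_irr _ (subset_trans WZ2 Za)) => ->; apply: res_irr.
Qed.

Definition stalk_setoid : setoid_ring.
Proof.
refine (@SetoidRing germ_rep germ_eq
  (@GermRep (opensT X) I 0) (@GermRep (opensT X) I 1)
  (fun a => GermRep (gr_in a) (- gr_sec a))
  (germ_op (fun A => +%R)) (germ_op (fun A => *%R)) _ _ _ _ _ _ _ _ _ _ _ _ _ _).
- by move=> a; exists (gr_nbhd a), (fun _ h => h), (fun _ h => h); split=> //; apply: gr_in.
- by move=> a b [W [Wa [Wb [Wx E]]]]; exists W, Wb, Wa.
- move=> a b c [W [Wa [Wb [Wx E]]]] [Z [Zb [Zc [Zx E']]]].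
  have WZ1 := @opensI_subl _ W Z.
  have WZ2 := @opensI_subr _ W Z.
  exists (opensI W Z), (subset_trans WZ1 Wa), (subset_trans WZ2 Zc); split=> //.
  rewrite -!res_res E -E' !res_res; exact: res_irr.
- move=> a b [W [Wa [Wb [Wx E]]]].
  by exists W, Wa, Wb; split=> //=; rewrite !rmorphN E.
- by move=> *; apply: germ_op_eq => // A B f u v; rewrite rmorphD.
- by move=> *; apply: germ_op_eq => // A B f u v; rewrite rmorphM.
- move=> [U Ux s] [V Vx t] [W Wx r].
  pose Z := opensI U (opensI V W).
  have Z2 : Z `<=` opensI (opensI U V) W by rewrite /= setIA.
  exists Z, (fun _ h => h), Z2; split=> //=.
  rewrite !rmorphD /= !res_res addrA.
  by congr (_ + _ + _); apply: res_irr.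
- move=> [U Ux s] [V Vx t].
  have Z2 : opensI U V `<=` opensI V U by rewrite /= setIC.
  exists (opensI U V), (fun _ h => h), Z2; split=> //=.
  rewrite !rmorphD /= !res_res addrC.
  by congr (_ + _); apply: res_irr.
- move=> [U Ux s].
  have Z1 : U `<=` opensI (opensT X) U by rewrite /= setTI.
  exists U, Z1, (fun _ h => h); split=> //=.
  by rewrite !rmorphD /= !res_res !rmorph0 add0r; apply: res_irr.
- move=> [U Ux s].
  have Z1 : U `<=` opensI U U by rewrite /= setIid.
  exists U, Z1, (@sub_opensT _ U); split=> //=.
  rewrite !rmorphD /= !res_res !rmorphN rmorph0.
  by apply/eqP; rewrite addrC subr_eq0; apply/eqP/res_irr.
- move=> [U Ux s] [V Vx t] [W Wx r].
  pose Z := opensI U (opensI V W).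
  have Z2 : Z `<=` opensI (opensI U V) W by rewrite /= setIA.
  exists Z, (fun _ h => h), Z2; split=> //=.
  rewrite !rmorphM /= !res_res mulrA.
  by congr (_ * _ * _); apply: res_irr.
- move=> [U Ux s] [V Vx t].
  have Z2 : opensI U V `<=` opensI V U by rewrite /= setIC.
  exists (opensI U V), (fun _ h => h), Z2; split=> //=.
  rewrite !rmorphM /= !res_res mulrC.
  by congr (_ * _); apply: res_irr.
- move=> [U Ux s].
  have Z1 : U `<=` opensI (opensT X) U by rewrite /= setTI.
  exists U, Z1, (fun _ h => h); split=> //=.
  by rewrite !rmorphM /= !res_res !rmorph1 mul1r; apply: res_irr.
- move=> [U Ux s] [V Vx t] [W Wx r].
  pose Z := opensI (opensI U V) W.
  have Z2 : Z `<=` opensI (opensI U W) (opensI V W) by rewrite /= -setIIl.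
  exists Z, (fun _ h => h), Z2; split=> //=.
  rewrite !(rmorphM, rmorphD) /= !res_res mulrDl.
  by congr (_ * _ + _ * _); apply: res_irr.
Defined.

Definition stalk : comPzRingType := sr_quot stalk_setoid.
Definition germ (U : opens X) (Ux : U x) (s : sec U) : stalk :=
  @sr_pi stalk_setoid (GermRep Ux s).

Lemma germP (U V : opens X) (Ux : U x) (Vx : V x) (s : sec U) (t : sec V) :
  germ Ux s = germ Vx t <->
  exists (W : opens X) (WU : W `<=` U) (WV : W `<=` V),
    W x /\ res WU s = res WV t.
Proof. exact: (@sr_piP stalk_setoid). Qed.

Lemma germ_res (U V : opens X) (VU : V `<=` U) (Vx : V x) (Ux : U x) (s : sec U) :
  germ Vx (res VU s) = germ Ux s.
Proof. by apply/germP; exists V, (fun _ h => h), VU; rewrite res_id. Qed.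

Lemma germ_surj (g : stalk) :
  exists (U : opens X) (Ux : U x) (s : sec U), g = germ Ux s.
Proof.
case E : (sr_repr g) => [U Ux s]; exists U, Ux, s.
by rewrite -(sr_reprK g) E.
Qed.

Section Germ.
Variables (U : opens X) (Ux : U x).
Lemma germ_zmod : zmod_morphism (germ Ux).
Proof.
move=> a b; rewrite /germ -(sr_piN (GermRep Ux b : sr_car stalk_setoid)) -sr_piD.
apply/sr_piP; have Z2 : U `<=` opensI U U by rewrite /= setIid.
exists U, (fun _ h => h), Z2; split=> //=.
rewrite !rmorphD /= !res_res !rmorphN /=.
by congr (_ - _); apply: res_irr.
Qed.
Lemma germ_monoid : monoid_morphism (germ Ux).
Proof.
split=> [|a b].
  apply/germP; exists U, (fun _ h => h), (@sub_opensT _ U).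
  by split=> //; rewrite !rmorph1.
rewrite /germ -sr_piM; apply/sr_piP; have Z2 : U `<=` opensI U U by rewrite /= setIid.
exists U, (fun _ h => h), Z2; split=> //=.
rewrite !rmorphM /= !res_res.
by congr (_ * _); apply: res_irr.
Qed.
HB.instance Definition _ := GRing.isZmodMorphism.Build _ _ (germ Ux) germ_zmod.
HB.instance Definition _ :=
  GRing.isMonoidMorphism.Build _ _ (germ Ux) germ_monoid.
End Germ.

Lemma germ_unit (U : opens X) (Ux : U x) (s : sec U) :
  is_unit (germ Ux s) <->
  exists (V : opens X) (VU : V `<=` U), V x /\ is_unit (res VU s).
Proof.
split=> [[g]|[V [VU [Vx [t ts]]]]]; last first.
  by exists (germ Vx t); rewrite -(germ_res VU Vx) -rmorphM ts rmorph1.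
have [V [Vx [t ->]]] := germ_surj g.
have Z1 := @opensI_subl _ U V; have Z2 := @opensI_subr _ U V.
have Zx : opensI U V x by [].
rewrite -(@germ_res _ (opensI U V) Z1 Zx) -(@germ_res _ (opensI U V) Z2 Zx).
rewrite -rmorphM -(rmorph1 (germ Zx)) => /germP[W [W1 [W2 [Wx E]]]].
exists W, (subset_trans W1 Z1); split=> //; exists (res (subset_trans W1 Z2) t).
rewrite (res_irr W2 W1) in E.
by move: E; rewrite !rmorph1 rmorphM !res_res.
Qed.
End Stalk.

(* Morphisms of locally ringed spaces: [comor] is the map O_Y -> f_* O_X and
   [mor_local] says that O_(Y,f(x)) -> O_(X,x) is a local homomorphism, as that map
   sends the germ of s to the germ of [comor s]. Between schemes these are exactly
   the morphisms of schemes. *)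
Record morphism (X Y : ringed_space) := Morphism {
  mor_fun :> X -> Y;
  mor_cont : continuous mor_fun;
  comor : forall V : opens Y, {rmorphism sec V -> sec (preim_opens mor_cont V)};
  comor_res : forall (V W : opens Y) (WV : W `<=` V)
      (fWV : preim_opens mor_cont W `<=` preim_opens mor_cont V) s,
    comor W (res WV s) = res fWV (comor V s);
  mor_local : forall (x : X) (V : opens Y) (Vx : V (mor_fun x)) (s : sec V),
    is_unit (@germ X x (preim_opens mor_cont V) Vx (comor V s)) ->
    is_unit (germ Vx s) }.

Arguments mor_cont {X Y} _ _ _.

(* Equality of morphisms, stated on sections over all open sets contained in both
   preimages because the latter are only propositionally equal. *)
Definition mor_eq (X Y : ringed_space) (f g : morphism X Y) : Prop :=
  (forall x, f x = g x) /\
  forall (V : opens Y) (s : sec V) (U : opens X)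
      (fU : U `<=` preim_opens (mor_cont f) V)
      (gU : U `<=` preim_opens (mor_cont g) V),
    res fU (comor f V s) = res gU (comor g V s).

Section Identity.
Variable X : ringed_space.

Lemma id_cont : continuous (@id X).
Proof. by move=> x; apply: cvg_id. Qed.

Definition id_comor (V : opens X) : {rmorphism sec V -> sec (preim_opens id_cont V)} :=
  @res X V (preim_opens id_cont V) (fun _ h => h).

Lemma id_comor_res (V W : opens X) (WV : W `<=` V)
    (h : preim_opens id_cont W `<=` preim_opens id_cont V) s :
  id_comor W (res WV s) = res h (id_comor V s).
Proof. by rewrite /id_comor !res_res; apply: res_irr. Qed.

Lemma id_local (x : X) (V : opens X) (Vx : V x) (s : sec V) :
  is_unit (@germ X x (preim_opens id_cont V) Vx (id_comor V s)) ->
  is_unit (germ Vx s).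
Proof. by rewrite /id_comor germ_res. Qed.

Definition mor_id : morphism X X := Morphism id_comor_res id_local.
End Identity.

Section Composition.
Variables (X Y Z : ringed_space) (g : morphism Y Z) (f : morphism X Y).

Lemma comp_cont : continuous (g \o f).
Proof. by move=> x; apply: continuous_comp; apply: mor_cont. Qed.

Definition comp_comor (V : opens Z) :
    {rmorphism sec V -> sec (preim_opens comp_cont V)} :=
  @res X (preim_opens (mor_cont f) (preim_opens (mor_cont g) V))
      (preim_opens comp_cont V) (fun _ h => h)
  \o comor f (preim_opens (mor_cont g) V) \o comor g V.

Lemma comp_comor_res (V W : opens Z) (WV : W `<=` V)
    (h : preim_opens comp_cont W `<=` preim_opens comp_cont V) s :
  comp_comor W (res WV s) = res h (comp_comor V s).
Proof.
have h1 : preim_opens (mor_cont g) W `<=` preim_opens (mor_cont g) V.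
  by move=> y; apply: WV.
rewrite /comp_comor /= (comor_res WV h1) (comor_res h1 h) !res_res.
exact: res_irr.
Qed.

Lemma comp_local (x : X) (V : opens Z) (Vx : V (g (f x))) (s : sec V) :
  is_unit (@germ X x (preim_opens comp_cont V) Vx (comp_comor V s)) ->
  is_unit (germ Vx s).
Proof.
rewrite /comp_comor /= germ_res => H.
apply: (mor_local (x := f x)); apply: (mor_local (x := x)); exact: H.
Qed.

Definition mor_comp : morphism X Z :=
  @Morphism X Z (g \o f) comp_cont comp_comor comp_comor_res comp_local.

End Composition.

Record prime_ideal (A : comPzRingType) := PrimeIdeal {
  pr_ideal :> ideal A;
  pr_proper : ~ pr_ideal 1;
  pr_prime : forall a b, pr_ideal (a * b) -> pr_ideal a \/ pr_ideal b }.

Section Zariski.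
Variable A : comPzRingType.
Implicit Types E F : set A.

(* The complements of the sets V(E) = {q | E is contained in q}. *)
Definition zariski_open (Z : set (prime_ideal A)) : Prop :=
  exists E : set A, Z = [set q : prime_ideal A | ~ E `<=` q].

Lemma zariski_openT : zariski_open setT.
Proof.
exists [set 1]; apply/seteqP; split=> // q _ /= h.
by apply: (@pr_proper A q); apply: h.
Qed.

Lemma zariski_openI : setI_closed zariski_open.
Proof.
move=> _ _ [E ->] [F ->]; exists [set e | exists2 a, E a & exists2 b, F b & e = a * b].
apply/seteqP; split=> q /=.
  move=> [nE nF] h; apply: nE => a Ea; apply: contrapT => nqa; apply: nF => b Fb.
  have /pr_prime[//|//] : q (a * b) by apply: h; exists a => //; exists b.
move=> h; split=> hE; apply: h => _ [a Ea [b Fb ->]].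
  by rewrite mulrC; apply/idealM/hE.
exact/idealM/hE.
Qed.

Lemma zariski_open_bigU (I : Type) (f : I -> set (prime_ideal A)) :
  (forall i, zariski_open (f i)) -> zariski_open (\bigcup_i f i).
Proof.
move=> fo; exists [set a | exists i E, f i = [set q | ~ E `<=` pr_ideal q] /\ E a].
apply/seteqP; split=> q /=.
  move=> [i _ fiq] h; have [E fE] := fo i.
  have nE : ~ E `<=` q by rewrite fE in fiq.
  by apply: nE => a Ea; apply: h; exists i, E.
move=> h; apply: contrapT => nf; apply: h => a [i [E [fE Ea]]].
apply: contrapT => nqa; apply: nf; exists i => //.
by rewrite fE /= => hE; apply/nqa/hE.
Qed.

HB.instance Definition _ := gen_eqMixin (prime_ideal A).
HB.instance Definition _ := gen_choiceMixin (prime_ideal A).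
HB.instance Definition _ := isOpenTopological.Build (prime_ideal A)
  zariski_openT zariski_openI zariski_open_bigU.

Definition basic_open (f : A) : set (prime_ideal A) := [set q : prime_ideal A | ~ q f].
End Zariski.

(* phi exhibits B as A[1/f]: the map A[1/f] -> B is well defined, surjective and
   injective. *)
Definition is_localization (A B : comPzRingType) (f : A) (phi : A -> B) : Prop :=
  [/\ is_unit (phi f),
      forall b, exists n a, phi f ^+ n * b = phi a
    & forall a, phi a = 0 -> exists n, f ^+ n * a = 0].

(* (U, O_U) is isomorphic to Spec A: a homeomorphism h from the prime spectrum onto
   U, and A -> O(U) inducing A[1/f] = O(D(f)) for every f, i.e. an isomorphism with
   the structure sheaf of Spec A on the basis of the D(f). *)
Definition affine (X : ringed_space) (U : opens X) : Prop :=
  exists (A : comPzRingType) (h : prime_ideal A -> X) (phi : {rmorphism A -> sec U}),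
  [/\ injective h, range h = U,
      forall Z : set (prime_ideal A), open Z <-> open (h @` Z)
    & forall (f : A) (V : opens X) (VU : V `<=` U),
        V = h @` basic_open f :> set X -> is_localization f (res VU \o phi)].

Definition scheme (X : ringed_space) : Prop :=
  forall x : X, exists U : opens X, U x /\ affine U.

(* A morphism X -> Spec R is a ring homomorphism R -> O(X). *)
Record ringed_space_over (R : comPzRingType) := RingedSpaceOver {
  rso_space :> ringed_space;
  rso_struct : {rmorphism R -> sec (opensT rso_space)} }.

Definition over_base (R : comPzRingType) (X Y : ringed_space_over R)
    (f : morphism X Y) : Prop :=
  forall r, comor f (opensT Y) (rso_struct Y r) =
    res (@sub_opensT _ (preim_opens (mor_cont f) (opensT Y))) (rso_struct X r).

(* [beta] factors through N \otimes_R B, where B is an R-algebra via [phi]. *)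
Definition balanced (R B : comPzRingType) (phi : {rmorphism R -> B})
    (N : lmodType R) (P : zmodType) (beta : N -> B -> P) : Prop :=
  [/\ forall m n b, beta (m + n) b = beta m b + beta n b,
      forall n b c, beta n (b + c) = beta n b + beta n c
    & forall r n b, beta (r *: n) b = beta n (phi r * b)].

(* \sum n_i \otimes b_i = 0 in N \otimes_R B: by the universal property, every
   balanced biadditive map kills the family. *)
Definition tensor_zero (R B : comPzRingType) (phi : {rmorphism R -> B})
    (N : lmodType R) (s : seq (N * B)) : Prop :=
  forall (P : zmodType) (beta : N -> B -> P), balanced phi beta ->
    \sum_(x <- s) beta x.1 x.2 = 0.

(* For M -> N injective, M \otimes_R B -> N \otimes_R B is injective. *)
Definition flat_hom (R B : comPzRingType) (phi : {rmorphism R -> B}) : Prop :=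
  forall (M N : lmodType R) (u : {linear M -> N}), injective u ->
  forall s : seq (M * B),
    tensor_zero phi [seq (u x.1, x.2) | x <- s] -> tensor_zero phi s.

(* All stalks O_(X,x) are flat R-modules. *)
Definition flat_over (R : comPzRingType) (X : ringed_space_over R) : Prop :=
  forall x : X, flat_hom (@germ X x (opensT X) I \o rso_struct X).

Section CharP.
Variables (p : nat) (p_pr : prime p) (k : fieldType) (k_char : p \in [pchar k]).
Local Notation W2k := (witt2 p_pr k).

Record k_scheme := KScheme {
  ks_space :> ringed_space_over k;
  ks_scheme : scheme ks_space }.

Section Frobenius.
Variable X : ringed_space_over k.
Implicit Type U : opens X.

Lemma sec_pnat U : p%:R = 0 :> sec U.
Proof.
rewrite -(rmorph_nat (res (@sub_opensT _ U) \o rso_struct X)).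
by rewrite (pcharf0 k_char) rmorph0.
Qed.

Lemma sec_mulrnp U (s : sec U) : s *+ p = 0.
Proof. by rewrite -mulr_natl sec_pnat mul0r. Qed.

Definition frobenius_sec U (s : sec U) : sec U := s ^+ p.
Lemma frobenius_sec_zmod U : zmod_morphism (@frobenius_sec U).
Proof.
move=> a b; apply: (addIr (frobenius_sec b)).
rewrite subrK /frobenius_sec -[in RHS](subrK b a) (witt_carryE p_pr (a - b) b).
by rewrite sec_mulrnp addr0.
Qed.
Lemma frobenius_sec_monoid U : monoid_morphism (@frobenius_sec U).
Proof. by split=> [|a b]; rewrite /frobenius_sec ?expr1n ?exprMn. Qed.
HB.instance Definition _ U :=
  GRing.isZmodMorphism.Build _ _ (@frobenius_sec U) (@frobenius_sec_zmod U).
HB.instance Definition _ U :=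
  GRing.isMonoidMorphism.Build _ _ (@frobenius_sec U) (@frobenius_sec_monoid U).

Definition frobenius_comor U :
    {rmorphism sec U -> sec (preim_opens (@id_cont X) U)} :=
  id_comor U \o @frobenius_sec U.

Lemma frobenius_comor_res (V W : opens X) (WV : W `<=` V)
    (h : preim_opens (@id_cont X) W `<=` preim_opens (@id_cont X) V)
    (s : sec V) :
  frobenius_comor W (res WV s) = res h (frobenius_comor V s).
Proof.
by rewrite /= /frobenius_sec -rmorphXn !res_res; apply: res_irr.
Qed.

Lemma frobenius_local (x : X) (V : opens X) (Vx : V x) (s : sec V) :
  is_unit (@germ X x (preim_opens (@id_cont X) V) Vx (frobenius_comor V s)) ->
  is_unit (germ Vx s).
Proof.
rewrite /= germ_res rmorphXn => -[b sb]; exists (germ Vx s ^+ p.-1 * b).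
by rewrite mulrA -exprS prednK ?prime_gt0.
Qed.

(* Identity on points, s |-> s^p on sections. *)
Definition absolute_frobenius : morphism X X :=
  Morphism frobenius_comor_res frobenius_local.
End Frobenius.

(* A space T over W_2(k) with a morphism X -> T over Spec k -> Spec W_2(k). *)
Record thickening (X : ringed_space_over k) := Thickening {
  th_space :> ringed_space_over W2k;
  th_emb : morphism X th_space;
  th_over : forall w : W2k,
    comor th_emb (opensT th_space) (rso_struct th_space w) =
    res (@sub_opensT _ (preim_opens (mor_cont th_emb) (opensT th_space)))
      (rso_struct X (w0 w)) }.

(* X -> T identifies X with T \otimes_(W_2(k)) k. Since W_2(k) -> k is surjective with
   square-zero kernel J, the latter is the space T with the sheaf O_T / J O_T: so i is
   a homeomorphism and O_T -> O_X is surjective on stalks with kernel generated by J. *)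
Definition closed_fibre (X : ringed_space_over k) (T : thickening X) : Prop :=
  let i := th_emb T in
  [/\ set_bij setT setT i,
      forall Z : set X, open Z -> open (i @` Z),
      forall (x : X) (U : opens X) (Ux : U x) (s : sec U),
        exists (V : opens T) (Vx : V (i x)) (t : sec V),
          @germ X x (preim_opens (mor_cont i) V) Vx (comor i V t) = germ Ux s
    & forall (x : X) (V : opens T) (Vx : V (i x)) (t : sec V),
        @germ X x (preim_opens (mor_cont i) V) Vx (comor i V t) = 0 ->
        exists s : seq (W2k * stalk (i x)),
          (forall y, y \in s -> w0 y.1 = 0) /\
          germ Vx t =
            \sum_(y <- s) @germ T (i x) (opensT T) I (rso_struct T y.1) * y.2].

Definition is_lifting (X : ringed_space_over k) (T : thickening X) : Prop :=
  [/\ scheme T, flat_over T & closed_fibre T].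

(* [fl_frob] is a morphism of schemes that is not required to be compatible with any
   map on Spec W_2(k). *)
Record frobenius_lifting (X : ringed_space_over k) := FrobeniusLifting {
  fl_lifting :> thickening X;
  fl_is_lifting : is_lifting fl_lifting;
  fl_frob : morphism fl_lifting fl_lifting;
  fl_frobP : mor_eq (mor_comp fl_frob (th_emb fl_lifting))
                    (mor_comp (th_emb fl_lifting) (absolute_frobenius X)) }.

(* O_X-linear sigma : F_* O_X -> O_X splitting O_X -> F_* O_X. The sections of F_* O_X
   over U are those of O_X, on which a acts as multiplication by a^p. *)
Record frobenius_splitting (X : ringed_space_over k) := FrobeniusSplitting {
  fs_fun :> forall U : opens X, sec U -> sec U;
  fs_res : forall (U V : opens X) (VU : V `<=` U) (s : sec U),
    fs_fun (res VU s) = res VU (fs_fun s);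
  fs_add : forall (U : opens X) (s t : sec U), fs_fun (s + t) = fs_fun s + fs_fun t;
  fs_linear : forall (U : opens X) (a s : sec U), fs_fun (a ^+ p * s) = a * fs_fun s;
  fs_split : forall (U : opens X) (a : sec U), fs_fun (a ^+ p) = a }.

Section CanonicalLifting.
Variables (X : ringed_space_over k) (sigma : frobenius_splitting X).
Implicit Type U : opens X.

Lemma fs0 U : sigma U 0 = 0.
Proof. by apply: (addIr (sigma U 0)); rewrite -fs_add !add0r. Qed.
Lemma fsB U s t : sigma U (s - t) = sigma U s - sigma U t.
Proof. by apply: (addIr (sigma U t)); rewrite -fs_add !subrK. Qed.

Definition cl_set U : set (witt2 p_pr (sec U)) :=
  [set a | w0 a = 0 /\ sigma U (w1 a) = 0].

Lemma cl_set0 U : cl_set (0 : witt2 p_pr (sec U)).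
Proof. by split=> //=; rewrite fs0. Qed.
Lemma cl_setD U (a b : witt2 p_pr (sec U)) :
  cl_set a -> cl_set b -> cl_set (a + b).
Proof.
move: a b => [a0 a1] [b0 b1] [/= -> a10] [/= -> b10]; split=> /=.
  by rewrite addr0.
by rewrite witt_carry0 subr0 fs_add a10 b10 addr0.
Qed.
Lemma cl_setM U (a b : witt2 p_pr (sec U)) : cl_set b -> cl_set (a * b).
Proof.
move: a b => [a0 a1] [b0 b1] [/= -> b10]; split=> /=; first by rewrite mulr0.
by rewrite sec_mulrnp expr0n gtn_eqF ?prime_gt0 // mul0r !addr0 fs_linear b10 mulr0.
Qed.
Definition cl_ideal U : ideal (witt2 p_pr (sec U)) :=
  Ideal (@cl_set0 U) (@cl_setD U) (@cl_setM U).

(* The presheaf U |-> W_2(O(U)) / {(0, f) | sigma f = 0}. It is already a sheaf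
   (see [cl_separated] and [cl_glue]), so no sheafification is needed: a class is
   determined by f_0 and sigma f_1, which can be arbitrary as sigma (g^p) = g. *)
Definition cl_sec U : comPzRingType := quotient_ring (cl_ideal U).
Definition cl_pi U (a : witt2 p_pr (sec U)) : cl_sec U := quotient_pi (cl_ideal U) a.
HB.instance Definition _ U := GRing.RMorphism.copy (@cl_pi U) (quotient_pi (cl_ideal U)).

Lemma cl_piP U (a b : witt2 p_pr (sec U)) :
  cl_pi a = cl_pi b <-> w0 a = w0 b /\ sigma U (w1 a) = sigma U (w1 b).
Proof.
rewrite [X in X <-> _](quotient_piP (cl_ideal U) a b).
have E : a = (a - b) + b by rewrite subrK.
split=> [[d0 d1]|[e0 e1]].
  rewrite E; case: (a - b) d0 d1 => u0 u1 /= -> du; case: b {E} => b0 b1 /=.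
  by rewrite add0r witt_carryC witt_carry0 subr0 fs_add du add0r.
move: e0 e1; rewrite {1 2}E; case: (a - b) => u0 u1; case: b {E} => b0 b1 /=.
move=> /(canRL (addrK _)); rewrite subrr => ->.
by rewrite witt_carryC witt_carry0 subr0 fs_add => /(canRL (addrK _)); rewrite subrr.
Qed.

Lemma cl_pi_surj U (q : cl_sec U) : exists a, q = cl_pi a.
Proof. exact: quotient_pi_surj. Qed.

Lemma cl_map_subproof (A : comPzRingType) U (f : {rmorphism witt2 p_pr (sec U) -> A}) :
  (forall a1, sigma U a1 = 0 -> f (Witt2 p_pr 0 a1) = 0) ->
  forall a, cl_ideal U a -> f a = 0.
Proof. by move=> f0 [a0 a1] [/= -> /f0]. Qed.

Definition cl_desc (A : comPzRingType) U (f : {rmorphism witt2 p_pr (sec U) -> A})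
    (f0 : forall a1, sigma U a1 = 0 -> f (Witt2 p_pr 0 a1) = 0) :
    {rmorphism cl_sec U -> A} :=
  quotient_desc (cl_map_subproof f0).

Lemma cl_descE (A : comPzRingType) U (f : {rmorphism witt2 p_pr (sec U) -> A}) f0 a :
  cl_desc (f := f) f0 (cl_pi a) = f a.
Proof. exact: quotient_descE. Qed.

Lemma cl_res_subproof (U V : opens X) (VU : V `<=` U) a1 :
  sigma U a1 = 0 ->
  (@cl_pi V \o witt2_map p_pr (res VU)) (Witt2 p_pr 0 a1) = 0.
Proof.
move=> a10; rewrite -(rmorph0 (@cl_pi V)); apply/cl_piP; split=> /=.
  by rewrite rmorph0.
by rewrite fs_res a10 rmorph0 fs0.
Qed.

Definition cl_res (U V : opens X) (VU : V `<=` U) : {rmorphism cl_sec U -> cl_sec V} :=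
  cl_desc (cl_res_subproof VU).

Lemma cl_resE (U V : opens X) (VU : V `<=` U) a :
  cl_res VU (cl_pi a) = cl_pi (Witt2 p_pr (res VU (w0 a)) (res VU (w1 a))).
Proof. by rewrite /cl_res cl_descE. Qed.

Lemma cl_res_id U (h : U `<=` U) s : cl_res h s = s.
Proof. by have [[a0 a1] ->] := cl_pi_surj s; rewrite cl_resE !res_id. Qed.

Lemma cl_res_comp (U V W : opens X) (h : V `<=` U) (h' : W `<=` V) (h'' : W `<=` U) s :
  cl_res h' (cl_res h s) = cl_res h'' s.
Proof.
by have [a ->] := cl_pi_surj s; rewrite !cl_resE /= !(res_comp _ _ h'').
Qed.

Lemma cl_separated (I : Type) U (V : I -> opens X) (VU : forall i, V i `<=` U) :
  U `<=` \bigcup_i V i ->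
  forall s t : cl_sec U, (forall i, cl_res (VU i) s = cl_res (VU i) t) -> s = t.
Proof.
move=> UV s t; have [[a0 a1] ->] := cl_pi_surj s; have [[b0 b1] ->] := cl_pi_surj t.
move=> E; apply/cl_piP; split=> /=; apply: (sec_separated VU UV) => i.
  by have := E i; rewrite !cl_resE => /cl_piP[].
by have := E i; rewrite !cl_resE => /cl_piP[_ /=]; rewrite !fs_res.
Qed.

Lemma cl_glue (I : Type) U (V : I -> opens X) (VU : forall i, V i `<=` U) :
  U `<=` \bigcup_i V i ->
  forall s : forall i, cl_sec (V i),
  (forall i j (W : opens X) (Wi : W `<=` V i) (Wj : W `<=` V j),
     cl_res Wi (s i) = cl_res Wj (s j)) ->
  exists t : cl_sec U, forall i, cl_res (VU i) t = s i.
Proof.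
move=> UV s sE.
pose a i := projT1 (cid (cl_pi_surj (s i))).
have aE i : s i = cl_pi (a i) := projT2 (cid (cl_pi_surj (s i))).
have [] := sec_glue VU UV (s := fun i => w0 (a i)).
  move=> i j W Wi Wj; have := sE i j W Wi Wj.
  by rewrite !aE !cl_resE => /cl_piP[].
move=> t0 t0E; have [] := sec_glue VU UV (s := fun i => sigma (V i) (w1 (a i))).
  move=> i j W Wi Wj; have := sE i j W Wi Wj.
  by rewrite !aE !cl_resE => /cl_piP[_ /=]; rewrite !fs_res.
move=> t1 t1E; exists (cl_pi (Witt2 p_pr t0 (t1 ^+ p))) => i.
rewrite cl_resE aE; apply/cl_piP; split=> /=; first exact: t0E.
by rewrite rmorphXn fs_split t1E.
Qed.

Definition canonical_space : ringed_space :=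
  RingedSpace cl_res_id cl_res_comp cl_separated cl_glue.

Definition canonical_struct : {rmorphism W2k -> sec (opensT canonical_space)} :=
  @cl_pi (opensT X) \o witt2_map p_pr (rso_struct X).

Definition canonical_over : ringed_space_over W2k := RingedSpaceOver canonical_struct.

Lemma cl_emb_subproof U a1 : sigma U a1 = 0 ->
  (id_comor U \o @witt2_proj p p_pr (sec U)) (Witt2 p_pr 0 a1) = 0.
Proof. by move=> _ /=; rewrite rmorph0. Qed.

Definition cl_emb_comor U :
    {rmorphism cl_sec U -> sec (preim_opens (@id_cont X) U)} :=
  cl_desc (@cl_emb_subproof U).

Lemma cl_emb_comorE U a : cl_emb_comor U (cl_pi a) = id_comor U (w0 a).
Proof. exact: cl_descE. Qed.

Lemma cl_emb_comor_res (V W : opens X) (WV : W `<=` V)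
    (h : preim_opens (@id_cont X) W `<=` preim_opens (@id_cont X) V)
    (s : cl_sec V) :
  cl_emb_comor W (cl_res WV s) = res h (cl_emb_comor V s).
Proof.
by have [a ->] := cl_pi_surj s; rewrite cl_resE !cl_emb_comorE /= !res_res; apply: res_irr.
Qed.

Lemma cl_unit U (a : witt2 p_pr (sec U)) : is_unit (w0 a) -> is_unit (cl_pi a).
Proof.
case: a => a0 a1 [/= b0 ab].
exists (cl_pi (Witt2 p_pr b0 (- (b0 ^+ p * b0 ^+ p * a1)))).
rewrite -rmorphM -(rmorph1 (@cl_pi U)); congr cl_pi; congr Witt2 => //=.
rewrite sec_mulrnp addr0 mulrN -mulrA (mulrA (a0 ^+ p)) -exprMn ab expr1n mul1r.
by rewrite addNr.
Qed.

Lemma cl_emb_local (x : X) (V : opens canonical_space) (Vx : V x)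
    (s : sec V) :
  is_unit (@germ X x (preim_opens (@id_cont X) V) Vx (cl_emb_comor V s)) ->
  is_unit (@germ canonical_space x V Vx s).
Proof.
have [[a0 a1] ->] := cl_pi_surj s; rewrite cl_emb_comorE /= germ_res.
move=> /germ_unit[W [WV [Wx u]]]; apply/germ_unit; exists W, WV; split=> //.
by rewrite cl_resE; apply: cl_unit.
Qed.

Definition canonical_emb : morphism X canonical_over :=
  @Morphism X canonical_over id (@id_cont X) cl_emb_comor
    cl_emb_comor_res cl_emb_local.

Lemma canonical_emb_over (w : W2k) :
  comor canonical_emb (opensT canonical_over) (canonical_struct w) =
  res (@sub_opensT _ (preim_opens (mor_cont canonical_emb) (opensT canonical_over)))
    (rso_struct X (w0 w)).
Proof.
apply: etrans (cl_emb_comorE (U := opensT X) (witt2_map p_pr (rso_struct X) w)) _.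
exact: res_irr.
Qed.

(* The ringed space (X, O_X~(sigma)) over W_2(k), where X -> X~(sigma) is the identity
   on points and (f_0, f_1) |-> f_0 on sections. *)
Definition canonical_lifting : thickening X := Thickening canonical_emb_over.
End CanonicalLifting.

Definition split_compatible (X Y : ringed_space_over k)
    (sigmaX : frobenius_splitting X) (sigmaY : frobenius_splitting Y)
    (f : morphism X Y) : Prop :=
  forall (V : opens Y) (s : sec V),
    comor f V (sigmaY V s) = sigmaX (preim_opens (mor_cont f) V) (comor f V s).

Section CanonicalMap.
Variables (X Y : ringed_space_over k).
Variables (sigmaX : frobenius_splitting X) (sigmaY : frobenius_splitting Y).
Variables (f : morphism X Y) (fsplit : split_compatible sigmaX sigmaY f).

Lemma cm_subproof (V : opens Y) a1 : sigmaY V a1 = 0 ->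
  (@cl_pi X sigmaX (preim_opens (mor_cont f) V) \o witt2_map p_pr (comor f V))
    (Witt2 p_pr 0 a1) = 0.
Proof.
move=> a10; rewrite -(rmorph0 (@cl_pi X sigmaX _)); apply/cl_piP; split=> /=.
  by rewrite rmorph0.
by rewrite -fsplit a10 rmorph0 fs0.
Qed.

Definition cm_comor (V : opens Y) :
    {rmorphism cl_sec sigmaY V -> cl_sec sigmaX (preim_opens (mor_cont f) V)} :=
  cl_desc (@cm_subproof V).

Lemma cm_comorE V a : cm_comor V (cl_pi sigmaY a) =
  cl_pi sigmaX (Witt2 p_pr (comor f V (w0 a)) (comor f V (w1 a))).
Proof. by rewrite /cm_comor cl_descE. Qed.

Lemma cm_comor_res (V W : opens Y) (WV : W `<=` V)
    (h : preim_opens (mor_cont f) W `<=` preim_opens (mor_cont f) V)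
    (s : cl_sec sigmaY V) :
  cm_comor W (cl_res sigmaY WV s) = cl_res sigmaX h (cm_comor V s).
Proof.
have [a ->] := cl_pi_surj s.
by rewrite cl_resE !cm_comorE cl_resE /= !(comor_res _ h).
Qed.

Lemma cm_local (x : X) (V : opens (canonical_space sigmaY)) (Vx : V (f x)) (s : sec V) :
  is_unit (@germ (canonical_space sigmaX) x (preim_opens (mor_cont f) V) Vx
             (cm_comor V s)) ->
  is_unit (@germ (canonical_space sigmaY) (f x) V Vx s).
Proof.
move=> /germ_unit[W [WV [Wx]]].
have [[a0 a1] ->] := cl_pi_surj s; rewrite cm_comorE cl_resE => -[q].
have [[b0 b1] ->] := cl_pi_surj q.
rewrite -rmorphM -(rmorph1 (@cl_pi X sigmaX W)) => /cl_piP[/= ab _].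
have : is_unit (@germ X x (preim_opens (mor_cont f) V) Vx (comor f V a0)).
  by apply/germ_unit; exists W, WV; split=> //; exists b0.
move=> /mor_local/germ_unit[Z [ZV [Zx u]]]; apply/germ_unit.
by exists Z, ZV; split=> //; rewrite [X in is_unit X]cl_resE; apply: cl_unit.
Qed.

(* The morphism of canonical liftings induced by f and W_2 of its map on sections. *)
Definition canonical_map :
    morphism (canonical_lifting sigmaX) (canonical_lifting sigmaY) :=
  @Morphism (canonical_lifting sigmaX) (canonical_lifting sigmaY)
    f (mor_cont f) cm_comor cm_comor_res cm_local.
End CanonicalMap.

(* Isomorphisms over W_2(k) which induce the identity on X. *)
Record lifting_iso (X : ringed_space_over k) (T T' : thickening X) := LiftingIso {
  li_mor :> morphism T T';
  li_inv : morphism T' T;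
  li_invl : mor_eq (mor_comp li_inv li_mor) (mor_id T);
  li_invr : mor_eq (mor_comp li_mor li_inv) (mor_id T');
  li_over : over_base li_mor;
  li_fibre : mor_eq (mor_comp li_mor (th_emb T)) (th_emb T') }.

(* Morphisms of schemes with a Frobenius lifting and a Frobenius splitting. *)
Record frobenius_map (X Y : k_scheme)
    (LX : frobenius_lifting X) (sigmaX : frobenius_splitting X)
    (LY : frobenius_lifting Y) (sigmaY : frobenius_splitting Y) := FrobeniusMap {
  fm_base : morphism X Y;
  fm_lift : morphism LX LY;
  fm_base_over : over_base fm_base;
  fm_lift_over : over_base fm_lift;
  fm_liftP : mor_eq (mor_comp fm_lift (th_emb LX)) (mor_comp (th_emb LY) fm_base);
  fm_frob : mor_eq (mor_comp fm_lift (fl_frob LX)) (mor_comp (fl_frob LY) fm_lift);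
  fm_split : split_compatible sigmaX sigmaY fm_base }.
End CharP.

(* Main.v *)
Require Import Defs.
From HB Require Import structures.
From mathcomp Require Import all_boot all_algebra ring.
From mathcomp Require Import boolp classical_sets functions topology.
Set Implicit Arguments.
Unset Strict Implicit.
Unset Printing Implicit Defensive.
Import GRing.Theory Num.Theory.
Local Open Scope classical_set_scope.
Local Open Scope ring_scope.

(** Let i : X -> T be the inclusion of X in its lifting T, and F the lift of Frobenius.
    By flatness, p u = 0 on T forces u to vanish on X ([emb_torsion]); since k is perfect,
    the sections of T vanishing on X are locally multiples of p ([emb_kernel]). As F lifts
    t |-> t ^ p, locally F t = t ^ p + p u, where u is determined up to the sections
    vanishing on X. So the restriction of u to X is a global section [delta] t, and
    expanding F (s + t) and F (s t) shows that
      [theta] t = (t restricted to X, delta t) : O_T -> W_2 (O_X)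
    is a ring morphism; it is the morphism which an endomorphism lifting Frobenius
    gives on p-torsion-free rings, cut down to length two. Composing with the quotient
    map gives the comparison of O_T with W_2 (O_X) / {(0, f) | sigma f = 0}.

    It is bijective because theta (p u) = p theta u = (0, u ^ p), whose class is
    determined by sigma (u ^ p) = u: this gives injectivity ([comparison_inj]) and,
    together with the existence of local lifts, surjectivity ([comparison_surj]), which
    is checked locally thanks to injectivity ([comor_bij]). It is W_2(k)-linear since
    ring morphisms W_2(k) -> W_2(A) with the same first component, where A has
    characteristic p, are equal ([witt2_morph_unique]).

    Naturality ([comparison_natural]) holds because a morphism commuting with the lifts
    of Frobenius preserves the equations F t = t ^ p + p u. That the canonical lifting is
    a flat scheme is deduced from the same properties of T along the isomorphism, while
    its closed fibre is computed directly ([canonical_closed_fibre]). *)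

(** * Witt vectors of length two in characteristic p *)

Section WittCharP.
Variables (p : nat) (p_pr : prime p).

Definition witt2_ghost (A : comPzRingType) (a : witt2 p_pr A) : A :=
  w0 a ^+ p + w1 a *+ p.

Lemma witt2_ghost_nat (A : comPzRingType) n :
  witt2_ghost (n%:R : witt2 p_pr A) = n%:R.
Proof.
elim: n => [|n IH]; first by rewrite /witt2_ghost /= mul0rn expr0n gtn_eqF ?prime_gt0 ?addr0.
rewrite !mulrS -{}IH /witt2_ghost /= witt_carryE // expr1n add0r.
by rewrite mulrnBl; ring.
Qed.

Lemma witt2_w0_nat (A : comPzRingType) n : w0 (n%:R : witt2 p_pr A) = n%:R.
Proof. exact: (rmorph_nat (@witt2_proj p p_pr A)). Qed.

Let ghost_nat_w1 (x : int) : p%:R ^+ p + x *+ p = p%:R -> x = 1 - p%:R ^+ p.-1.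
Proof.
have -> : p%:R ^+ p = p%:R * p%:R ^+ p.-1 :> int by rewrite -exprS prednK ?prime_gt0.
move: (p%:R ^+ p.-1) => P E; apply/eqP; rewrite -subr_eq0.
have : (x - (1 - P)) *+ p = 0.
  rewrite -[LHS]mulr_natl; move: E; rewrite -[x *+ p]mulr_natl; move: (p%:R) => c E.
  by apply: etrans (_ : c * P + c * x - c = 0); [ring | rewrite E subrr].
by move/eqP; rewrite mulrn_eq0 gtn_eqF ?prime_gt0.
Qed.

Variables (A : comPzRingType) (A_char : p%:R = 0 :> A).
Implicit Types a b : witt2 p_pr A.

Lemma char_mulrn (x : A) : x *+ p = 0.
Proof. by rewrite -mulr_natl A_char mul0r. Qed.

(** Over the integers the ghost map determines w1 p = 1 - p ^ (p - 1), and this is 1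
    in characteristic p. *)
Lemma witt2_natp : p%:R = Witt2 p_pr 0 1 :> witt2 p_pr A.
Proof.
apply: witt2_eq; rewrite /= ?witt2_w0_nat //.
pose q : witt2 p_pr int := p%:R.
have q1 : w1 q = 1 - p%:R ^+ p.-1.
  have := witt2_ghost_nat int p; rewrite /witt2_ghost witt2_w0_nat -/q.
  by move: (w1 q) => x; apply: ghost_nat_w1.
have -> : (p%:R : witt2 p_pr A) = witt2_map p_pr (intr : {rmorphism int -> A}) q.
  by rewrite rmorph_nat.
rewrite /= q1 rmorphB rmorphXn /= rmorph1.
rewrite (rmorph_nat (intr : {rmorphism int -> A})) A_char expr0n gtn_eqF ?subr0 //.
by rewrite -ltnS prednK ?prime_gt1 ?prime_gt0.
Qed.

(** This is the identity p = V F of Witt vectors in characteristic p. *)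
Lemma witt2_mulrnp a : a *+ p = Witt2 p_pr 0 (w0 a ^+ p).
Proof.
rewrite -mulr_natl witt2_natp; apply: witt2_eq; rewrite /= ?mul0r //.
by rewrite expr0n gtn_eqF ?prime_gt0 // char_mulrn mul0r addr0 add0r mulr1.
Qed.

Lemma witt2_ker_mul a b : w0 a = 0 -> w0 b = 0 -> a * b = 0.
Proof.
case: a b => [a0 a1] [b0 b1] /= -> ->; apply: witt2_eq; rewrite /= ?mul0r //.
by rewrite char_mulrn expr0n gtn_eqF ?prime_gt0 // !mul0r !addr0.
Qed.

(** If a = z + b with w0 z = 0, then z ^ p = 0 since p >= 2, and the carry of z and b
    has first component 0, hence is killed by p. *)
Lemma witt2_exprp a b : w0 a = w0 b -> a ^+ p = b ^+ p.
Proof.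
move=> E; have z0 : w0 (a - b) = 0 by rewrite /= E subrr.
rewrite -(subrK b a); set z := a - b in z0 *.
have zp : z ^+ p = 0.
  have -> : z ^+ p = z ^+ (2 + (p - 2)) by rewrite subnKC ?prime_gt1.
  by rewrite exprD expr2 (witt2_ker_mul z0 z0) mul0r.
rewrite witt_carryE // witt2_mulrnp zp add0r.
have -> : w0 (witt_carry p z b) = witt_carry p (w0 z) (w0 b).
  exact: (witt_carry_morph p (@witt2_proj p p_pr A) z b).
rewrite z0 witt_carryC // witt_carry0 expr0n gtn_eqF ?prime_gt0 //.
by rewrite -[RHS]add0r addrC.
Qed.
End WittCharP.

Section WittPerfect.
Variables (p : nat) (p_pr : prime p) (k : fieldType).
Variables (k_char : p \in [pchar k]) (k_perfect : forall a : k, exists b : k, b ^+ p = a).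

Lemma witt2_kerP (w : witt2 p_pr k) : w0 w = 0 -> exists v, w = v *+ p.
Proof.
case: w => w0 w1 /= ->; have [b <-] := k_perfect w1.
exists (Witt2 p_pr b 0); rewrite witt2_mulrnp //; exact: pcharf0 k_char.
Qed.

(** A ring map from W_2(k) to W_2(A) is determined by its first component: every
    element of W_2(k) has the form s ^ p + p t, and in W_2(A) both x ^ p and p x depend
    only on the first component of x. *)
Lemma witt2_morph_unique (A : comPzRingType) (f g : {rmorphism witt2 p_pr k -> witt2 p_pr A}) :
  p%:R = 0 :> A -> (forall w, w0 (f w) = w0 (g w)) -> f =1 g.
Proof.
move=> A_char fg w; have [b bw] := k_perfect (w0 w).
pose s := Witt2 p_pr b 0.
have sw : w0 (w - s ^+ p) = 0.
  by rewrite /= (rmorphXn (@witt2_proj p p_pr k) p s : w0 _ = _) /= bw subrr.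
have [v vE] := witt2_kerP sw.
rewrite -(subrK (s ^+ p) w) vE !rmorphD !rmorphMn !rmorphXn.
by rewrite !witt2_mulrnp // (witt2_exprp A_char (fg s)) fg.
Qed.
End WittPerfect.

(** * Ringed spaces: stalks, gluing and isomorphisms *)

Lemma rmorph_bij_inv (A B : comPzRingType) (f : {rmorphism A -> B}) :
  bijective f -> exists g : {rmorphism B -> A}, cancel f g /\ cancel g f.
Proof.
move=> [g fK gK].
have gz : zmod_morphism g by move=> a b; rewrite -{1}(gK a) -{1}(gK b) -rmorphB fK.
have gm : monoid_morphism g.
  by split=> [|a b]; rewrite -?(rmorph1 f) ?fK // -{1}(gK a) -{1}(gK b) -rmorphM fK.
pose h : {rmorphism B -> A} := HB.pack g
  (GRing.isZmodMorphism.Build _ _ g gz) (GRing.isMonoidMorphism.Build _ _ g gm).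
by exists h.
Qed.

Section Sheaf.
Variable X : ringed_space.
Implicit Types U V W : opens X.

Lemma opens_eq (T : topologicalType) (U V : opens T) : U = V :> set T -> U = V.
Proof.
case: U V => [U oU] [V oV] /= E; move: oU oV; rewrite E => oU oV.
by rewrite (Prop_irrelevance oU oV).
Qed.

Lemma sec_local U (s t : sec U) :
  (forall x, U x -> exists V (VU : V `<=` U), V x /\ res VU s = res VU t) -> s = t.
Proof.
move=> H; pose J := {V : opens X | exists VU : V `<=` U, res VU s = res VU t}.
have JU (j : J) : sval j `<=` U by case: (svalP j).
have UJ : U `<=` \bigcup_(j : J) sval j.
  move=> x Ux; have [V [VU [Vx E]]] := H x Ux.
  by exists (exist _ V (ex_intro _ VU E)).
apply: (sec_separated JU UJ) => j.
by have [VU E] := svalP j; rewrite !(res_irr (JU j) VU).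
Qed.

Lemma germ0P x U (Ux : U x) (s : sec U) :
  germ Ux s = 0 <-> exists V (VU : V `<=` U), V x /\ res VU s = 0.
Proof.
rewrite -(rmorph0 (germ Ux)); split.
  move=> /germP[V [VU [VU' [Vx E]]]]; exists V, VU; split=> //.
  by rewrite E rmorph0.
by move=> [V [VU [Vx E]]]; apply/germP; exists V, VU, VU; rewrite E rmorph0.
Qed.

(** Local data which exist near every point and are unique wherever they exist
    agree on overlaps, so they glue. *)
Lemma glue_unique U (P : forall V, sec V -> Prop) :
  (forall V W (WV : W `<=` V) s, P V s -> P W (res WV s)) ->
  (forall V s t, P V s -> P V t -> s = t) ->
  (forall x, U x -> exists V s, [/\ V x, V `<=` U & P V s]) ->
  exists s : sec U, forall V (VU : V `<=` U) t, P V t -> res VU s = t.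
Proof.
move=> Pres Puniq Ploc.
pose J := {V : opens X & {s : sec V | V `<=` U /\ P V s}}.
pose V_ (j : J) := projT1 j; pose s_ (j : J) : sec (V_ j) := sval (projT2 j).
have JU (j : J) : V_ j `<=` U by case: j => V [s []].
have JP (j : J) : P _ (s_ j) by case: j => V [s []].
have UJ : U `<=` \bigcup_j V_ j.
  move=> x Ux; have [V [s [Vx VU PV]]] := Ploc x Ux.
  by exists (existT _ V (exist _ s (conj VU PV))).
have [|s sE] := sec_glue JU UJ (s := s_).
  by move=> i j W Wi Wj; apply: (Puniq W); apply/Pres/JP.
exists s => V VU t Pt.
exact: etrans (res_irr _ _ _) (sE (existT _ V (exist _ t (conj VU Pt)))).
Qed.
End Sheaf.

Lemma germ_surj2 (X : ringed_space) (x : X) (g h : stalk x) :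
  exists (V : opens X) (Vx : V x) (s t : sec V), g = germ Vx s /\ h = germ Vx t.
Proof.
have [U [Ux [s ->]]] := germ_surj g; have [V [Vx [t ->]]] := germ_surj h.
have UVx : opensI U V x by [].
exists (opensI U V), UVx, (res (@opensI_subl _ U V) s), (res (@opensI_subr _ U V) t).
by rewrite !germ_res.
Qed.

Lemma comor_comp (X Y Z : ringed_space) (g : morphism Y Z) (f : morphism X Y)
    (V : opens Z) (s : sec V) (U : opens X)
    (h : U `<=` preim_opens (mor_cont (mor_comp g f)) V)
    (h' : U `<=` preim_opens (mor_cont f) (preim_opens (mor_cont g) V)) :
  res h (comor (mor_comp g f) V s) = res h' (comor f _ (comor g V s)).
Proof. by rewrite /= res_res; apply: res_irr. Qed.

Section StalkMap.
Variables (X Y : ringed_space) (f : morphism X Y) (x : X).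

(** [sr_repr] chooses a representative of a germ; [stalk_mapE] shows that the choice is
    irrelevant. *)
Definition stalk_map (g : stalk (f x)) : stalk x :=
  @germ X x (preim_opens (mor_cont f) (gr_nbhd (sr_repr g)))
    (gr_in (sr_repr g)) (comor f _ (gr_sec (sr_repr g))).

Lemma stalk_mapE (V : opens Y) (Vx : V (f x)) (s : sec V) :
  stalk_map (germ Vx s) = @germ X x (preim_opens (mor_cont f) V) Vx (comor f V s).
Proof.
have [W [W1 [W2 [Wx E]]]] := @sr_pi_repr (stalk_setoid (f x)) (GermRep Vx s).
have h1 : preim_opens (mor_cont f) W `<=`
    preim_opens (mor_cont f) (gr_nbhd (sr_repr (germ Vx s))).
  by move=> y; apply: W1.
have h2 : preim_opens (mor_cont f) W `<=` preim_opens (mor_cont f) V.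
  by move=> y; apply: W2.
apply/germP; exists (preim_opens (mor_cont f) W), h1, h2; split=> //.
by rewrite -(comor_res W1 h1) -(comor_res W2 h2) E.
Qed.

Lemma stalk_map_zmod : zmod_morphism stalk_map.
Proof.
move=> g h; have [V [Vx [s [t [-> ->]]]]] := germ_surj2 g h.
by rewrite -rmorphB !stalk_mapE !rmorphB.
Qed.
Lemma stalk_map_monoid : monoid_morphism stalk_map.
Proof.
split=> [|g h]; last first.
  have [V [Vx [s [t [-> ->]]]]] := germ_surj2 g h.
  by rewrite -rmorphM !stalk_mapE !rmorphM.
rewrite -(rmorph1 (@germ Y (f x) (opensT Y) I)) stalk_mapE.
by rewrite !rmorph1.
Qed.
HB.instance Definition _ :=
  GRing.isZmodMorphism.Build _ _ stalk_map stalk_map_zmod.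
HB.instance Definition _ :=
  GRing.isMonoidMorphism.Build _ _ stalk_map stalk_map_monoid.
End StalkMap.
Arguments stalk_map {X Y} f x g.

Section LocalIso.
Variables (X Y : ringed_space) (f : morphism X Y).
Hypothesis f_inj : forall (V : opens Y) (s : sec V), comor f V s = 0 -> s = 0.

(** Local preimages of a section are unique by injectivity, so they glue to a
    preimage. *)
Lemma comor_bij :
  (forall (V : opens Y) (t : sec (preim_opens (mor_cont f) V)) (y : Y), V y ->
     exists (W : opens Y) (WV : W `<=` V)
       (fWV : preim_opens (mor_cont f) W `<=` preim_opens (mor_cont f) V) (s : sec W),
       W y /\ comor f W s = res fWV t) ->
  forall V : opens Y, bijective (comor f V).
Proof.
move=> f_loc V.
have inj : injective (comor f V).
  by move=> s t E; apply/subr0_eq/f_inj; rewrite rmorphB E subrr.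
have surj (t : sec (preim_opens (mor_cont f) V)) : exists s, comor f V s = t.
  pose P W (s : sec W) :=
    exists fWV : preim_opens (mor_cont f) W `<=` preim_opens (mor_cont f) V,
      comor f W s = res fWV t.
  have [||| s sE] := @glue_unique Y V P.
  - move=> W W' W'W s [fWV E].
    have fW'W : preim_opens (mor_cont f) W' `<=` preim_opens (mor_cont f) W.
      by move=> x; apply: W'W.
    exists (subset_trans fW'W fWV).
    by rewrite (comor_res W'W fW'W) E res_res.
  - move=> W s s' [h E] [h' E']; apply/subr0_eq/f_inj; rewrite rmorphB E E'.
    by rewrite (res_irr h h') subrr.
  - move=> y /(f_loc V t y)[W [WV [fWV [s [Wy E]]]]].
    by exists W, s; split=> //; exists fWV.
  exists s; apply: sec_local => x /(f_loc V t (f x))[W [WV [fWV [s' [Wy E]]]]].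
  exists (preim_opens (mor_cont f) W), fWV; split=> //.
  by rewrite -(comor_res WV) (sE W WV s') //; exists fWV.
exists (fun t => projT1 (cid (surj t))) => s; last by case: cid.
by case: cid => s' /= /inj.
Qed.
End LocalIso.

Record homeomorphism (X Y : ringed_space) (f : morphism X Y) : Prop := Homeomorphism {
  homeo_inj : injective f;
  homeo_surj : forall y, exists x, f x = y;
  homeo_open : forall Z : set X, open Z -> open (f @` Z) }.

Section Homeo.
Variables (X Y : ringed_space) (f : morphism X Y) (f_homeo : homeomorphism f).

Definition im_opens (U : opens X) : opens Y :=
  Opens (homeo_open f_homeo (open_setP U)).

Lemma im_opensK U : preim_opens (mor_cont f) (im_opens U) = U.
Proof.
apply: opens_eq; apply/seteqP; split=> [x [y Uy /(homeo_inj f_homeo) <-]|x Ux] //.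
by exists x.
Qed.

Lemma preim_sub V W :
  preim_opens (mor_cont f) W `<=` preim_opens (mor_cont f) V -> W `<=` V.
Proof. by move=> h y; have [x <-] := homeo_surj f_homeo y; apply: h. Qed.

Hypothesis f_bij : forall V : opens Y, bijective (comor f V).

(** Every neighbourhood of x is the preimage of its image, so germs at x can be
    represented over preimages, where comor is bijective. *)
Lemma stalk_map_bij x : bijective (stalk_map f x).
Proof.
have inj0 (g : stalk (f x)) : stalk_map f x g = 0 -> g = 0.
  have [V [Vx [s ->]]] := germ_surj g; rewrite stalk_mapE => /germ0P[W [WV [Wx E]]].
  have WV' : im_opens W `<=` V by apply: preim_sub; rewrite im_opensK.
  have Wx' : im_opens W (f x) by exists x.
  apply/germ0P; exists (im_opens W), WV'; split=> //.
  have fWV : preim_opens (mor_cont f) (im_opens W) `<=` preim_opens (mor_cont f) V.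
    by rewrite im_opensK.
  apply: (bij_inj (f_bij (im_opens W))); rewrite (comor_res WV' fWV) rmorph0.
  have fW : preim_opens (mor_cont f) (im_opens W) `<=` W by rewrite im_opensK.
  by rewrite -(res_comp WV fW) E rmorph0.
have inj : injective (stalk_map f x).
  by move=> g h E; apply/subr0_eq/inj0; rewrite rmorphB /= E subrr.
have surj t : exists g, stalk_map f x g = t.
  have [U [Ux [s ->]]] := germ_surj t.
  have fU : preim_opens (mor_cont f) (im_opens U) `<=` U by rewrite im_opensK.
  have Ux' : im_opens U (f x) by exists x.
  have [h _ hK] := f_bij (im_opens U).
  exists (germ Ux' (h (res fU s))); rewrite stalk_mapE hK.
  by rewrite germ_res.
exists (fun t => projT1 (cid (surj t))) => s; last by case: cid.
by case: cid => s' /= /inj.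
Qed.

(** On sections over U, the inverse is the inverse of comor over V = g^-1 U. It starts
    with a restriction from U to f^-1 V, because these are only propositionally equal. *)
Lemma morphism_inverse : exists h : morphism Y X,
  mor_eq (mor_comp h f) (mor_id X) /\ mor_eq (mor_comp f h) (mor_id Y).
Proof.
pose g y := projT1 (cid (homeo_surj f_homeo y)).
have gK y : f (g y) = y by rewrite /g; case: cid.
have fK x : g (f x) = x by apply: (homeo_inj f_homeo).
have g_cont : continuous g.
  apply/continuousP => U oU; have -> : g @^-1` U = f @` U.
    by apply/seteqP; split=> [y Uy|_ [x Ux <-]] /=; [exists (g y) | rewrite fK].
  exact: homeo_open.
have fgU (U : opens X) :
    preim_opens (mor_cont f) (preim_opens g_cont U) `<=` U.
  by move=> x /=; rewrite fK.
have phi_ex (U : opens X) : exists phi : {rmorphism sec U -> sec (preim_opens g_cont U)},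
    forall s, comor f _ (phi s) = res (fgU U) s.
  have [h [_ hK]] := rmorph_bij_inv (f_bij (preim_opens g_cont U)).
  by exists (h \o res (fgU U)) => s /=; rewrite hK.
pose phi U := projT1 (cid (phi_ex U)).
have phiE U s : comor f _ (phi U s) = res (fgU U) s by rewrite /phi; case: cid.
have phi_res (V W : opens X) (WV : W `<=` V)
    (gWV : preim_opens g_cont W `<=` preim_opens g_cont V) s :
    phi W (res WV s) = res gWV (phi V s).
  apply: (bij_inj (f_bij _)); rewrite phiE res_res.
  have fgWV : preim_opens (mor_cont f) (preim_opens g_cont W) `<=`
               preim_opens (mor_cont f) (preim_opens g_cont V).
    by move=> x; apply: gWV.
  by rewrite (comor_res gWV fgWV) phiE res_res; apply: res_irr.
have phi_local (y : Y) (V : opens X) (Vy : V (g y)) (s : sec V) :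
    is_unit (@germ Y y (preim_opens g_cont V) Vy (phi V s)) -> is_unit (germ Vy s).
  move=> /germ_unit[W [WV [Wy [t E]]]]; apply/germ_unit.
  have fWV : preim_opens (mor_cont f) W `<=`
              preim_opens (mor_cont f) (preim_opens g_cont V).
    by move=> x; apply: WV.
  exists (preim_opens (mor_cont f) W), (subset_trans fWV (fgU V)).
  split; first by rewrite /= gK.
  exists (comor f W t); rewrite -res_res -phiE -(comor_res WV fWV) -rmorphM E.
  exact: rmorph1.
exists (Morphism phi_res phi_local); split; split=> // V s U h1 h2 /=.
- by rewrite phiE /id_comor !res_res; apply: res_irr.
- have gfV : preim_opens g_cont (preim_opens (mor_cont f) V) `<=` V.
    by move=> y /=; rewrite gK.
  have -> : phi _ (comor f V s) = res gfV s.
    apply: (bij_inj (f_bij _)); rewrite phiE.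
    by rewrite (comor_res gfV (fgU _)).
  by rewrite /id_comor !res_res; apply: res_irr.
Qed.
End Homeo.

(** * Liftings as first-order thickenings with kernel generated by p *)

Section ResidueModule.
Variables (p : nat) (p_pr : prime p) (k : fieldType) (k_char : p \in [pchar k]).
Local Notation W2k := (witt2 p_pr k).

(** The field k as a module over W_2(k). The two proofs are parameters so that the type
    determines the ring W_2(k) and its characteristic. *)
Definition residue_module (_ : prime p) (_ : p \in [pchar k]) : Type := k.
Local Notation kmod := (residue_module p_pr k_char).
HB.instance Definition _ := GRing.Zmodule.on kmod.

Let scale (w : W2k) (c : kmod) : kmod := w0 w * (c : k).
Let scaleA w w' c : scale w (scale w' c) = scale (w * w') c.
Proof. by rewrite /scale mulrA. Qed.
Let scale1 : left_id 1 scale.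
Proof. by move=> c; rewrite /scale mul1r. Qed.
Let scaleDr : right_distributive scale +%R.
Proof. by move=> w c d; rewrite /scale mulrDr. Qed.
Let scaleDl c : {morph scale^~ c : w w' / w + w'}.
Proof. by move=> w w'; rewrite /scale mulrDl. Qed.
HB.instance Definition _ :=
  GRing.Zmodule_isLmodule.Build W2k kmod scaleA scale1 scaleDr scaleDl.

Lemma residue_scaleE (w : W2k) (c : kmod) : w *: c = w0 w * (c : k) :> k.
Proof. by []. Qed.

(** The Verschiebung after Frobenius: multiplication by p on W_2(k), which factors through
    w0 ([residue_mulpE]). *)
Definition residue_mulp (c : kmod) : W2k^o := Witt2 p_pr 0 ((c : k) ^+ p).

Lemma residue_mulpE (a : W2k) : residue_mulp (w0 a) = a *+ p :> W2k.
Proof. by rewrite witt2_mulrnp // (pcharf0 k_char). Qed.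

Lemma residue_mulp_zmod : zmod_morphism residue_mulp.
Proof.
move=> a b; have := residue_mulpE (Witt2 p_pr a 0 - Witt2 p_pr b 0).
by rewrite mulrnBl -!residue_mulpE.
Qed.
Lemma residue_mulp_scalable : scalable residue_mulp.
Proof.
move=> w c; have := residue_mulpE (w * Witt2 p_pr c 0).
by rewrite -mulrnAr -residue_mulpE.
Qed.
HB.instance Definition _ :=
  GRing.isZmodMorphism.Build kmod W2k^o residue_mulp residue_mulp_zmod.
HB.instance Definition _ :=
  GRing.isScalable.Build W2k kmod W2k^o *:%R residue_mulp residue_mulp_scalable.

Lemma residue_mulp_inj : injective residue_mulp.
Proof.
move=> a b /(congr1 (@w1 _ _ _)) E.
exact: (fmorph_inj (pFrobenius_aut k_char) E).
Qed.

(** Flatness is applied to the injection k -> W_2(k) which maps 1 to p: if p b = 0,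
    then 1 (x) b becomes p (x) b = 1 (x) p b = 0 in W_2(k) (x) B, so 1 (x) b = 0 in
    k (x) B, and its image f b under k (x) B -> C is zero. *)
Lemma flat_torsion (B C : comPzRingType) (phi : {rmorphism W2k -> B})
    (psi : {rmorphism k -> C}) (f : {rmorphism B -> C}) :
  flat_hom phi -> (forall w, f (phi w) = psi (w0 w)) ->
  forall b, b *+ p = 0 -> f b = 0.
Proof.
move=> flat fphi b pb.
have /(flat _ _ residue_mulp residue_mulp_inj [:: ((1 : k) : kmod, b)]) : tensor_zero phi
    [seq (residue_mulp x.1, x.2) | x <- [:: ((1 : k) : kmod, b)]].
  move=> P beta [_ betaD betaZ]; rewrite /= big_seq1 /=.
  have -> : residue_mulp (1 : k) = (p%:R : W2k) *: (1 : W2k^o).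
    by rewrite /GRing.scale /= mulr1 -(residue_mulpE 1).
  rewrite betaZ rmorph_nat mulr_natl pb.
  by apply: (addIr (beta 1 0)); rewrite -betaD !add0r.
(* The map k (x) B -> C. *)
move=> /(_ C (fun c y => psi c * f y)); rewrite big_seq1 /= rmorph1 mul1r; apply.
split=> [m n y|m y z|w n y]; rewrite ?rmorphD ?mulrDl ?mulrDr //.
by rewrite residue_scaleE !rmorphM fphi mulrCA mulrA [psi _ * psi _]mulrC.
Qed.
End ResidueModule.

Section Lifting.
Variables (p : nat) (p_pr : prime p) (k : fieldType) (k_char : p \in [pchar k]).
Hypothesis k_perfect : forall a : k, exists b : k, b ^+ p = a.
Variables (X : ringed_space_over k) (T : thickening p_pr X).
Hypothesis T_lift : is_lifting T.
Local Notation i := (th_emb T).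
Local Notation "i^-1 V" := (preim_opens (mor_cont i) V) (at level 10, V at level 9).

Lemma emb_homeo : homeomorphism i.
Proof.
have [_ _ [[_ inj surj] i_open _ _]] := T_lift; split=> // [x y|y].
  by apply: inj; rewrite inE.
by have [x _ <-] := surj y I; exists x.
Qed.

Lemma preim_subset (V W : opens T) : W `<=` V -> i^-1 W `<=` i^-1 V.
Proof. by move=> WV x; apply: WV. Qed.

Lemma stalk_emb_struct x w :
  stalk_map i x (@germ T (i x) (opensT T) I (rso_struct T w)) =
  @germ X x (opensT X) I (rso_struct X (w0 w)).
Proof. by rewrite stalk_mapE th_over; apply: germ_res. Qed.

Lemma stalk_torsion x (g : stalk (i x)) : g *+ p = 0 -> stalk_map i x g = 0.
Proof.
have [_ T_flat _] := T_lift.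
apply: (flat_torsion k_char (psi := @germ X x (opensT X) I \o rso_struct X) (T_flat (i x))).
exact: stalk_emb_struct.
Qed.

(** The kernel is generated by the w in W_2(k) with w0 w = 0, and these are multiples
    of p since k is perfect. *)
Lemma stalk_kernel x (g : stalk (i x)) :
  stalk_map i x g = 0 -> exists h, g = h *+ p.
Proof.
have [V [Vx [t ->]]] := germ_surj g; rewrite stalk_mapE.
have [_ _ [_ _ _ ker]] := T_lift => /ker[s [s0 ->]] {ker}.
elim: s s0 => [|y s IH] s0; first by exists 0; rewrite big_nil mul0rn.
have [h hE] : exists h, \sum_(y <- s)
    @germ T (i x) (opensT T) I (rso_struct T y.1) * y.2 = h *+ p.
  by apply: IH => z zs; apply: s0; rewrite inE zs orbT.
have [v vE] := witt2_kerP k_char k_perfect (s0 y (mem_head _ _)).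
exists (germ (I : opensT T (i x)) (rso_struct T v) * y.2 + h).
by rewrite big_cons hE vE !rmorphMn mulrnDl mulrnAl.
Qed.

Lemma emb_torsion V (t : sec V) : t *+ p = 0 -> comor i V t = 0.
Proof.
move=> tp; apply: sec_local => x Vx.
have /germ0P[W [WV [Wx E]]] : @germ X x (i^-1 V) Vx (comor i V t) = 0.
  by rewrite -stalk_mapE; apply: stalk_torsion; rewrite -rmorphMn tp rmorph0.
by exists W, WV; rewrite E rmorph0.
Qed.

Lemma emb_kernel V (t : sec V) y : comor i V t = 0 -> V y ->
  exists (W : opens T) (WV : W `<=` V) u, W y /\ res WV t = u *+ p.
Proof.
move=> t0 Vy; have [x xy] := homeo_surj emb_homeo y.
move: Vy; rewrite -{}xy => {y} Vx.
have [|h hE] := @stalk_kernel x (germ Vx t).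
  by rewrite stalk_mapE t0 rmorph0.
have [U [Ux [u uE]]] := germ_surj h; move: hE; rewrite uE -rmorphMn.
move=> /germP[W [WV [WU [Wx E]]]].
by exists W, WV, (res WU u); rewrite E rmorphMn.
Qed.

Lemma lifting_mulrnp2 (V : opens T) (t : sec V) : t *+ p *+ p = 0.
Proof.
have pp : p%:R * p%:R = 0 :> witt2 p_pr k.
  have k_p : p%:R = 0 :> k by apply: pcharf0.
  by apply: witt2_ker_mul; rewrite ?witt2_w0_nat.
have E : p%:R * p%:R = 0 :> sec V.
  rewrite -(rmorph_nat (res (@sub_opensT _ V) \o rso_struct T)) -rmorphM pp.
  exact: rmorph0.
by rewrite -[LHS]mulr_natl -[t *+ p]mulr_natl mulrA E mul0r.
Qed.

(** A lift of a germ is defined on a small neighbourhood, on which it restricts to the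
    given section; this neighbourhood of x is open in T because i is open. *)
Lemma emb_lift x (U : opens X) (Ux : U x) (s : sec U) :
  exists (V : opens T) (VU : i^-1 V `<=` U) t, V (i x) /\ comor i V t = res VU s.
Proof.
have [_ _ [_ _ lift _]] := T_lift.
have [V [Vx [t /germP[W [WV [WU [Wx E]]]]]]] := lift x U Ux s.
pose W' := im_opens emb_homeo W.
have iW : i^-1 W' `<=` W by rewrite im_opensK.
have W'V : W' `<=` V by apply: (preim_sub emb_homeo); rewrite im_opensK.
exists W', (subset_trans iW WU), (res W'V t); split; first by exists x.
rewrite (comor_res W'V (subset_trans iW WV)) -res_res E.
exact: res_res.
Qed.
End Lifting.

(** * The map to Witt vectors given by a lifting of Frobenius *)

Section FrobeniusQuotient.
Variables (p : nat) (p_pr : prime p) (k : fieldType) (k_char : p \in [pchar k]).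
Hypothesis k_perfect : forall a : k, exists b : k, b ^+ p = a.
Variables (X : ringed_space_over k) (L : frobenius_lifting p_pr k_char X).
Local Notation i := (th_emb L).
Local Notation "i^-1 V" := (preim_opens (mor_cont i) V) (at level 10, V at level 9).
Let L_lift : is_lifting L := fl_is_lifting L.

(** F i = i F_X, where i is bijective and F_X is the identity on points, so F is the
    identity on points as well. *)
Lemma frob_sub (V : opens L) : V `<=` preim_opens (mor_cont (fl_frob L)) V.
Proof.
move=> y; have [x <-] := homeo_surj (emb_homeo L_lift) y => Vx.
by have /= E := (fl_frobP L).1 x; rewrite /= E.
Qed.

Definition frob_sec (V : opens L) : {rmorphism sec V -> sec V} :=
  res (@frob_sub V) \o comor (fl_frob L) V.

Lemma frob_sec_res (V W : opens L) (WV : W `<=` V) (t : sec V) :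
  frob_sec W (res WV t) = res WV (frob_sec V t).
Proof.
have h : preim_opens (mor_cont (fl_frob L)) W `<=` preim_opens (mor_cont (fl_frob L)) V.
  by move=> y; apply: WV.
by rewrite /frob_sec /= (comor_res WV h) !res_res; apply: res_irr.
Qed.

Lemma emb_frob_sec (V : opens L) (t : sec V) :
  comor i V (frob_sec V t) = comor i V t ^+ p.
Proof.
have h1 : i^-1 V `<=` preim_opens (mor_cont (mor_comp (fl_frob L) i)) V.
  by move=> x; apply: frob_sub.
have h2 : i^-1 V `<=` preim_opens (mor_cont (mor_comp i (absolute_frobenius p_pr k_char X))) V.
  by [].
have := (fl_frobP L).2 V t (i^-1 V) h1 h2.
rewrite /= /frobenius_sec /id_comor !res_res res_id => <-.
by rewrite /frob_sec /= (comor_res (@frob_sub V) h1); apply: res_irr.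
Qed.

Definition frob_quotient (V : opens L) (t u : sec V) : Prop :=
  frob_sec V t = t ^+ p + u *+ p.

Lemma frob_quotient_res (V W : opens L) (WV : W `<=` V) (t u : sec V) :
  frob_quotient t u -> frob_quotient (res WV t) (res WV u).
Proof. by rewrite /frob_quotient frob_sec_res => ->; rewrite rmorphD rmorphXn rmorphMn. Qed.

Lemma frob_quotient_ex (V : opens L) (t : sec V) x : V (i x) ->
  exists (W : opens L) (WV : W `<=` V) u, W (i x) /\ frob_quotient (res WV t) u.
Proof.
move=> Vx; have t0 : comor i V (frob_sec V t - t ^+ p) = 0.
  by rewrite rmorphB emb_frob_sec rmorphXn subrr.
have [W [WV [u [Wx E]]]] := emb_kernel k_char k_perfect L_lift t0 Vx.
exists W, WV, u; split=> //; rewrite /frob_quotient frob_sec_res.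
by rewrite -E rmorphB rmorphXn addrC subrK.
Qed.

Lemma frob_quotient_uniq (V : opens L) (t u v : sec V) :
  frob_quotient t u -> frob_quotient t v -> comor i V u = comor i V v.
Proof.
move=> E E'; apply/subr0_eq; rewrite -rmorphB; apply: (emb_torsion k_char L_lift).
by rewrite mulrnBl; apply/eqP; rewrite subr_eq0; apply/eqP/(addrI (t ^+ p)); rewrite -E.
Qed.

(** Locally the lift of Frobenius is t ^ p + p u; the section u is only defined up
    to multiples of p, so that its image in O_X is well defined and glues. *)
Lemma delta_ex (V : opens L) (t : sec V) : exists d : sec (i^-1 V),
  forall (W : opens L) (WV : W `<=` V) (iWV : i^-1 W `<=` i^-1 V) u,
    frob_quotient (res WV t) u -> res iWV d = comor i W u.
Proof.
pose P (U : opens X) (d : sec U) := exists (W : opens L) (WV : W `<=` V)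
  (UW : U `<=` i^-1 W) u, frob_quotient (res WV t) u /\ res UW (comor i W u) = d.
have [||| d dE] := @glue_unique X (i^-1 V) P.
- move=> U U' U'U d [W [WV [UW [u [tu <-]]]]].
  by exists W, WV, (subset_trans U'U UW), u; rewrite res_res.
- move=> U d d' [W [WV [UW [u [tu <-]]]]] [W' [WV' [UW' [u' [tu' <-]]]]].
  pose Z := opensI W W'.
  have ZW : Z `<=` W := @opensI_subl _ W W'.
  have ZW' : Z `<=` W' := @opensI_subr _ W W'.
  have UZ : U `<=` i^-1 Z by move=> x Ux; split; [apply: UW | apply: UW'].
  rewrite -(res_comp (preim_subset ZW) UZ) -(comor_res ZW).
  rewrite -(res_comp (preim_subset ZW') UZ) -(comor_res ZW').
  congr (res UZ _); apply: (frob_quotient_uniq (t := res (subset_trans ZW WV) t)).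
    by rewrite -res_res; apply: frob_quotient_res.
  by rewrite -(res_comp WV' ZW'); apply: frob_quotient_res.
- move=> x Vx; have [W [WV [u [Wx tu]]]] := frob_quotient_ex t Vx.
  exists (i^-1 W), (comor i W u); split=> //; first exact: preim_subset.
  by exists W, WV, (fun _ h => h), u; rewrite res_id.
by exists d => W WV iWV u tu; apply: dE; exists W, WV, (fun _ h => h), u; rewrite res_id.
Qed.

Definition delta (V : opens L) (t : sec V) : sec (i^-1 V) := projT1 (cid (delta_ex t)).

Lemma delta_local (V W : opens L) (WV : W `<=` V) (iWV : i^-1 W `<=` i^-1 V) (t : sec V) u :
  frob_quotient (res WV t) u -> res iWV (delta t) = comor i W u.
Proof. by rewrite /delta; case: cid => d dE; apply: dE. Qed.

Lemma deltaE (V : opens L) (t u : sec V) : frob_quotient t u -> delta t = comor i V u.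
Proof.
move=> tu; have h : V `<=` V by [].
by rewrite -(@delta_local V V h (fun _ h => h) t) ?res_id.
Qed.

Lemma delta_res (V W : opens L) (WV : W `<=` V) (iWV : i^-1 W `<=` i^-1 V) (t : sec V) :
  delta (res WV t) = res iWV (delta t).
Proof.
apply: sec_local => x Wx; have [Z [ZW [u [Zx tu]]]] := frob_quotient_ex (res WV t) Wx.
exists (i^-1 Z), (preim_subset ZW); split=> //.
rewrite (delta_local (preim_subset ZW) tu) res_res.
by rewrite res_res in tu; rewrite (delta_local _ tu).
Qed.

Definition theta (V : opens L) (t : sec V) : witt2 p_pr (sec (i^-1 V)) :=
  Witt2 p_pr (comor i V t) (delta t).

Lemma theta_res (V W : opens L) (WV : W `<=` V) (iWV : i^-1 W `<=` i^-1 V) (t : sec V) :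
  theta (res WV t) = witt2_map p_pr (res iWV) (theta t).
Proof. by rewrite /theta (delta_res WV iWV) (comor_res WV iWV). Qed.

Lemma witt2_local (U : opens X) (a b : witt2 p_pr (sec U)) :
  (forall x, U x -> exists (V : opens X) (VU : V `<=` U),
     V x /\ witt2_map p_pr (res VU) a = witt2_map p_pr (res VU) b) -> a = b.
Proof.
move=> H; apply: witt2_eq; apply: sec_local => x /H[V [VU [Vx E]]];
  by exists V, VU; split=> //; case: E.
Qed.

(** Both sections have Frobenius quotients near every point, so an equality of Witt
    vectors may be checked where these quotients exist. *)
Lemma theta_local2 (V : opens L) (s t : sec V) (a b : witt2 p_pr (sec (i^-1 V))) :
  (forall (W : opens L) (WV : W `<=` V) (iWV : i^-1 W `<=` i^-1 V) u v,
     frob_quotient (res WV s) u -> frob_quotient (res WV t) v ->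
     witt2_map p_pr (res iWV) a = witt2_map p_pr (res iWV) b) -> a = b.
Proof.
move=> H; apply: witt2_local => x Vx.
have [W [WV [u [Wx su]]]] := frob_quotient_ex s Vx.
have [Z [ZW [v [Zx tv]]]] := frob_quotient_ex (res WV t) Wx.
exists (i^-1 Z), (preim_subset (subset_trans ZW WV)); split=> //.
apply: (H Z (subset_trans ZW WV) _ (res ZW u) v).
  by rewrite -res_res; apply: frob_quotient_res.
by rewrite -res_res.
Qed.

Lemma thetaD (V : opens L) (s t : sec V) : theta (s + t) = theta s + theta t.
Proof.
apply: (theta_local2 (s := s) (t := t)) => W WV iWV u v su tv.
rewrite rmorphD /= -!(theta_res WV) rmorphD; apply: witt2_eq => /=; first exact: rmorphD.
rewrite (deltaE su) (deltaE tv) -(witt_carry_morph p (comor i W)) -!(rmorphD, rmorphB).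
apply: deltaE; rewrite /frob_quotient !rmorphD su tv (witt_carryE p_pr).
by rewrite mulrnBl mulrnDl; ring.
Qed.

Lemma thetaM (V : opens L) (s t : sec V) : theta (s * t) = theta s * theta t.
Proof.
apply: (theta_local2 (s := s) (t := t)) => W WV iWV u v su tv.
rewrite rmorphM /= -!(theta_res WV) rmorphM; apply: witt2_eq => /=; first exact: rmorphM.
rewrite (deltaE su) (deltaE tv) -!rmorphXn -!(rmorphM, rmorphD, rmorphMn).
apply: deltaE; rewrite /frob_quotient !rmorphM su tv exprMn !(rmorphXn (res WV));
by rewrite /=; ring.
Qed.

Lemma theta1 (V : opens L) : theta (1 : sec V) = 1.
Proof.
apply: witt2_eq; rewrite /= ?rmorph1 //.
rewrite (deltaE (u := 0)) ?rmorph0 // /frob_quotient.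
by rewrite rmorph1 expr1n mul0rn addr0.
Qed.

Lemma theta_zmod (V : opens L) : zmod_morphism (@theta V).
Proof. by move=> s t; apply/(addIr (theta t)); rewrite -thetaD !subrK. Qed.
Lemma theta_monoid (V : opens L) : monoid_morphism (@theta V).
Proof. by split; [apply: theta1 | apply: thetaM]. Qed.
HB.instance Definition _ (V : opens L) :=
  GRing.isZmodMorphism.Build _ _ (@theta V) (@theta_zmod V).
HB.instance Definition _ (V : opens L) :=
  GRing.isMonoidMorphism.Build _ _ (@theta V) (@theta_monoid V).
End FrobeniusQuotient.

(** * The isomorphism with the canonical lifting *)

Section Comparison.
Variables (p : nat) (p_pr : prime p) (k : fieldType) (k_char : p \in [pchar k]).
Hypothesis k_perfect : forall a : k, exists b : k, b ^+ p = a.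
Variables (X : ringed_space_over k) (L : frobenius_lifting p_pr k_char X).
Variable sigma : frobenius_splitting p X.
Local Notation C := (canonical_lifting p_pr k_char sigma).
Local Notation i := (th_emb L).
Local Notation "i^-1 V" := (preim_opens (mor_cont i) V) (at level 10, V at level 9).
Let L_lift : is_lifting L := fl_is_lifting L.

Lemma theta_mulrnp (V : opens L) (u : sec V) :
  theta k_perfect (u *+ p) = Witt2 p_pr 0 (comor i V u ^+ p).
Proof. by rewrite rmorphMn witt2_mulrnp //; apply: (sec_pnat k_char). Qed.

Definition comparison_comor (V : opens L) :
    {rmorphism sec V -> cl_sec p_pr k_char sigma (i^-1 V)} :=
  @cl_pi p p_pr k k_char X sigma (i^-1 V) \o @theta p p_pr k k_char k_perfect X L V.

Lemma comparison_res (V W : opens L) (WV : W `<=` V) (iWV : i^-1 W `<=` i^-1 V) (t : sec V) :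
  comparison_comor W (res WV t) = cl_res p_pr k_char sigma iWV (comparison_comor V t).
Proof.
rewrite /comparison_comor /= (theta_res _ WV iWV).
exact: esym (cl_resE k_char sigma iWV (theta k_perfect t)).
Qed.

Lemma comparison_local (x : C) (V : opens L) (Vx : V (i x)) (t : sec V) :
  is_unit (@germ C x (i^-1 V) Vx (comparison_comor V t)) -> is_unit (germ Vx t).
Proof.
move=> /germ_unit[W [WV [Wx]]].
rewrite [X in is_unit X](cl_resE k_char sigma WV (theta k_perfect t)) => -[q].
have [b ->] := cl_pi_surj q; rewrite -rmorphM -(rmorph1 (@cl_pi p p_pr k k_char X sigma W)).
move=> /cl_piP[/= tb _]; apply: (@mor_local X L i x V Vx t).
by apply/germ_unit; exists W, WV; split=> //; exists (w0 b).
Qed.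

Definition comparison : morphism C L :=
  @Morphism C L i (mor_cont i) comparison_comor comparison_res comparison_local.

Lemma comparison_homeo : homeomorphism comparison.
Proof. by have [inj surj op] := emb_homeo L_lift; split. Qed.

Lemma comparison_over : over_base comparison.
Proof.
move=> w; apply: etrans (esym (cl_resE k_char sigma _ _)); rewrite /= /comparison_comor /=.
congr (cl_pi _ _ _).
pose f : {rmorphism witt2 p_pr k -> witt2 p_pr (sec (i^-1 (opensT L)))} :=
  @theta p p_pr k k_char k_perfect X L (opensT L) \o rso_struct L.
pose g : {rmorphism witt2 p_pr k -> witt2 p_pr (sec (i^-1 (opensT L)))} :=
  witt2_map p_pr (res (@sub_opensT X (i^-1 (opensT L))) \o rso_struct X).
apply: (witt2_morph_unique k_char k_perfect (f := f) (g := g)); first exact: (sec_pnat k_char).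
by move=> v; rewrite /= th_over.
Qed.

(** A section killed by the comparison is of the form p u, with image (0, u ^ p);
    then u = sigma (u ^ p) vanishes on X, so that u is again divisible by p. *)
Lemma comparison_inj (V : opens L) (t : sec V) : comor comparison V t = 0 -> t = 0.
Proof.
rewrite /= -(rmorph0 (@cl_pi p p_pr k k_char X sigma (i^-1 V))).
move=> /cl_piP[/= t0]; rewrite fs0 => sd0.
apply: sec_local => y Vy; have [W [WV [u [Wy E]]]] := emb_kernel k_char k_perfect L_lift t0 Vy.
have iWV := preim_subset (T := L) WV.
have u0 : comor i W u = 0.
  have := congr1 (@w1 _ _ _) (theta_mulrnp u).
  rewrite -E (theta_res _ WV iWV) /= => /(congr1 (sigma _)).
  by rewrite fs_res sd0 rmorph0 fs_split.
have [Z [ZW [v [Zy E']]]] := emb_kernel k_char k_perfect L_lift u0 Wy.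
exists Z, (subset_trans ZW WV); split=> //.
by rewrite -res_res E rmorphMn /= E' (lifting_mulrnp2 k_char) rmorph0.
Qed.

(** To hit the class of (f_0, f_1), lift f_0 to t; the difference with theta t is
    (0, g), in the class of (0, sigma(g) ^ p), and this is the image of p u for any
    lift u of sigma(g). *)
Lemma comparison_surj (V : opens L) (q : cl_sec p_pr k_char sigma (i^-1 V)) (y : L) : V y ->
  exists (W : opens L) (WV : W `<=` V) (iWV : i^-1 W `<=` i^-1 V) s,
    W y /\ comparison_comor W s = cl_res p_pr k_char sigma iWV q.
Proof.
have [x <-] := homeo_surj (emb_homeo L_lift) y => {y} Vx.
have [a ->] := cl_pi_surj q.
have [V1 [iV1 [t [V1x tE]]]] := emb_lift L_lift (U := i^-1 V) Vx (w0 a).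
have [b [b0 aE]] : exists b, w0 b = 0 /\ witt2_map p_pr (res iV1) a = theta k_perfect t + b.
  exists (witt2_map p_pr (res iV1) a - theta k_perfect t).
  by rewrite /= tE subrr addrC subrK.
have [V2 [iV2 [u [V2x uE]]]] := emb_lift L_lift (U := i^-1 V1) V1x (sigma _ (w1 b)).
have V1V : V1 `<=` V := preim_sub (emb_homeo L_lift) iV1.
have V2V1 : V2 `<=` V1 := preim_sub (emb_homeo L_lift) iV2.
exists V2, (subset_trans V2V1 V1V), (subset_trans iV2 iV1), (res V2V1 t + u *+ p).
split=> //.
rewrite rmorphD cl_resE /= theta_mulrnp (theta_res _ V2V1 iV2).
have -> : Witt2 p_pr (res (subset_trans iV2 iV1) (w0 a)) (res (subset_trans iV2 iV1) (w1 a)) =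
    witt2_map p_pr (res iV2) (theta k_perfect t + b).
  by rewrite -aE /witt2_map /= !res_res.
rewrite !rmorphD; congr (_ + _); apply/cl_piP; split=> /=; first by rewrite b0 rmorph0.
by rewrite fs_split uE fs_res.
Qed.

Lemma comparison_bij (V : opens L) : bijective (comor comparison V).
Proof.
apply: (comor_bij comparison_inj) => W q y Wy.
exact: (comparison_surj q Wy).
Qed.

Lemma comparison_fibre : mor_eq (mor_comp comparison (th_emb C)) i.
Proof.
split=> // V t U h1 h2; have /= E := cl_emb_comorE k_char sigma (theta k_perfect t).
by rewrite /= /comparison_comor /= E /id_comor !res_res; apply: res_irr.
Qed.

Lemma comparison_iso : {f : lifting_iso C L | li_mor f = comparison}.
Proof.
have [h [hl hr]] := cid (morphism_inverse comparison_homeo comparison_bij).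
by exists (LiftingIso hl hr comparison_over comparison_fibre).
Qed.
End Comparison.

Section Naturality.
Variables (p : nat) (p_pr : prime p) (k : fieldType) (k_char : p \in [pchar k]).
Hypothesis k_perfect : forall a : k, exists b : k, b ^+ p = a.
Variables (X Y : k_scheme k).
Variables (LX : frobenius_lifting p_pr k_char X) (sigmaX : frobenius_splitting p X).
Variables (LY : frobenius_lifting p_pr k_char Y) (sigmaY : frobenius_splitting p Y).
Variable f : frobenius_map LX sigmaX LY sigmaY.
Local Notation iX := (th_emb LX).
Local Notation iY := (th_emb LY).
Local Notation b := (fm_base f).
Local Notation g := (fm_lift f).

Lemma frob_sec_natural (W : opens LY) (s : sec W) :
  frob_sec _ (comor g W s) = comor g W (frob_sec W s).
Proof.
have h1 : preim_opens (mor_cont g) W `<=` preim_opens (mor_cont (mor_comp g (fl_frob LX))) W.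
  exact: (@frob_sub _ _ _ _ _ LX (preim_opens (mor_cont g) W)).
have h2 : preim_opens (mor_cont g) W `<=` preim_opens (mor_cont (mor_comp (fl_frob LY) g)) W.
  by move=> x; apply: (@frob_sub _ _ _ _ _ LY W).
have := (fm_frob f).2 W s (preim_opens (mor_cont g) W) h1 h2.
rewrite /frob_sec /= !res_res (comor_res (@frob_sub _ _ _ _ _ LY W) h2) => E.
exact: etrans (res_irr _ _ _) (etrans E (res_irr _ _ _)).
Qed.

Lemma emb_natural (V : opens LY) (t : sec V) (U : opens X)
    (h : U `<=` preim_opens (mor_cont b) (preim_opens (mor_cont iY) V))
    (h' : U `<=` preim_opens (mor_cont iX) (preim_opens (mor_cont g) V)) :
  res h (comor b _ (comor iY V t)) = res h' (comor iX _ (comor g V t)).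
Proof.
have := (fm_liftP f).2 V t U h' h; rewrite /= !res_res.
rewrite (res_irr _ h') => ->; exact: res_irr.
Qed.

(** A morphism which commutes with the lifts of Frobenius sends a local equation
    F t = t ^ p + p u to the corresponding equation for the images of t and u. *)
Lemma delta_natural (V : opens LY) (t : sec V) (U : opens X)
    (h : U `<=` preim_opens (mor_cont b) (preim_opens (mor_cont iY) V))
    (h' : U `<=` preim_opens (mor_cont iX) (preim_opens (mor_cont g) V)) :
  res h (comor b _ (delta k_perfect t)) = res h' (delta k_perfect (comor g V t)).
Proof.
have gi x : iY (b x) = g (iX x) := esym ((fm_liftP f).1 x).
apply: sec_local => x Ux; have Vx : V (iY (b x)) := h x Ux.
have [W [WV [u [Wx tu]]]] := frob_quotient_ex k_perfect t Vx.
pose Z := opensI U (preim_opens (mor_cont b) (preim_opens (mor_cont iY) W)).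
have ZU : Z `<=` U := @opensI_subl _ _ _.
have Zb : Z `<=` preim_opens (mor_cont b) (preim_opens (mor_cont iY) W) := @opensI_subr _ _ _.
have Zg : Z `<=` preim_opens (mor_cont iX) (preim_opens (mor_cont g) W).
  by move=> z /Zb /=; rewrite gi.
have gWV : preim_opens (mor_cont g) W `<=` preim_opens (mor_cont g) V.
  by move=> z; apply: WV.
have bWV : preim_opens (mor_cont b) (preim_opens (mor_cont iY) W) `<=`
    preim_opens (mor_cont b) (preim_opens (mor_cont iY) V).
  by move=> z; apply: WV.
exists Z, ZU; split; first by split.
rewrite !res_res -(res_comp bWV Zb) -(comor_res (preim_subset WV) bWV).
rewrite (delta_local k_perfect (preim_subset WV) tu) (emb_natural u Zb Zg).
rewrite -(res_comp (preim_subset gWV) Zg); congr (res Zg _); apply/esym/delta_local.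
by rewrite -(comor_res WV gWV) /frob_quotient frob_sec_natural tu rmorphD rmorphXn rmorphMn.
Qed.

Lemma comparison_natural :
  mor_eq (mor_comp (comparison k_perfect LY sigmaY) (canonical_map p_pr k_char (fm_split f)))
         (mor_comp g (comparison k_perfect LX sigmaX)).
Proof.
split=> [x|V t U h1 h2]; first exact: esym ((fm_liftP f).1 x).
have h1' : U `<=` preim_opens (mor_cont b) (preim_opens (mor_cont iY) V) := h1.
have h2' : U `<=` preim_opens (mor_cont iX) (preim_opens (mor_cont g) V) := h2.
rewrite (comor_comp t h1 h1') (comor_comp t h2 h2').
have E := cm_comorE k_char (fm_split f) (theta k_perfect t).
apply: etrans (congr1 (cl_res p_pr k_char sigmaX h1') E) _.
apply: etrans (cl_resE k_char sigmaX h1' _) _.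
apply: etrans _ (esym (cl_resE k_char sigmaX h2' (theta k_perfect (comor g V t)))).
congr (cl_pi _ _ _); apply: witt2_eq; [exact: emb_natural | exact: delta_natural].
Qed.
End Naturality.

(** * Transport along the comparison *)

(** Balanced maps over B and over C correspond to each other through f and its
    inverse. *)
Lemma flat_hom_iso (R B C : comPzRingType) (phi : {rmorphism R -> B})
    (psi : {rmorphism R -> C}) (f : {rmorphism B -> C}) :
  bijective f -> (forall r, f (phi r) = psi r) -> flat_hom phi -> flat_hom psi.
Proof.
move=> /rmorph_bij_inv[g [fK gK]] fE flat M N u u_inj s s0.
have gE r : g (psi r) = phi r by rewrite -fE fK.
pose s' := [seq (x.1, g x.2) | x <- s].
have s'0 : tensor_zero phi s'.
  apply: (flat M N u u_inj) => P beta [bD bD' bZ].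
  have := s0 P (fun n c => beta n (g c)); rewrite !big_map /=; apply.
  by split=> *; rewrite ?rmorphD ?rmorphM ?gE.
move=> P beta [bD bD' bZ].
have := s'0 P (fun m b => beta m (f b)); rewrite big_map /=.
under eq_bigr do rewrite gK; apply.
by split=> *; rewrite ?rmorphD ?rmorphM ?fE.
Qed.

Lemma localization_iso (A B C : comPzRingType) (a : A) (phi : {rmorphism A -> B})
    (psi : {rmorphism A -> C}) (h : {rmorphism B -> C}) :
  bijective h -> (forall x, h (phi x) = psi x) ->
  is_localization a phi -> is_localization a psi.
Proof.
move=> /rmorph_bij_inv[h' [hK h'K]] hE [[b ab] surj inj]; split.
- by exists (h b); rewrite -hE -rmorphM ab rmorph1.
- move=> c; have [n [x E]] := surj (h' c); exists n, x.
  by rewrite -!hE -E rmorphM rmorphXn h'K.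
- by move=> x; rewrite -hE -(rmorph0 h) => /(can_inj hK)/inj.
Qed.

Section SchemeIso.
Variables (X Y : ringed_space) (f : morphism X Y).
Hypotheses (f_homeo : homeomorphism f) (f_bij : forall V : opens Y, bijective (comor f V)).

(** The chart of V composed with the inverse of f on points. For the localization at a,
    an open set U = h' (D(a)) is the preimage of its image W = h (D(a)), so the map to
    O_X(U) is the one to O_Y(W) followed by an isomorphism. *)
Lemma affine_iso (V : opens Y) : affine V -> affine (preim_opens (mor_cont f) V).
Proof.
move=> [A [h [phi [h_inj hV h_open loc]]]].
pose h' q := projT1 (cid (homeo_surj f_homeo (h q))).
have fh' q : f (h' q) = h q by rewrite /h'; case: cid.
have imh (Z : set (prime_ideal A)) : f @` (h' @` Z) = h @` Z.
  apply/seteqP; split=> [_ [_ [q Zq <-] <-]|_ [q Zq <-]].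
    by exists q => //; rewrite fh'.
  by exists (h' q); [exists q | rewrite fh'].
have preimh (Z : set (prime_ideal A)) : h' @` Z = f @^-1` (h @` Z).
  rewrite -imh; apply/seteqP; split=> [x Zx|x [y Zy /(homeo_inj f_homeo) <-]] //.
  by exists x.
exists A, h', (comor f V \o phi); split.
- by move=> q q' E; apply: h_inj; rewrite -!fh' E.
- by rewrite preimh hV.
- move=> Z; rewrite h_open preimh; split=> [o|o].
    by apply: open_comp o => x _; apply: mor_cont.
  by rewrite -imh preimh; apply: homeo_open.
- move=> a U UV UE.
  pose W := im_opens f_homeo U.
  have WE : W = h @` basic_open a :> set Y by rewrite /= UE imh.
  have WV : W `<=` V by apply: (preim_sub f_homeo); rewrite im_opensK.
  have UW : U `<=` preim_opens (mor_cont f) W by rewrite im_opensK.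
  have res_bij : bijective (res UW).
    have WU : preim_opens (mor_cont f) W `<=` U by rewrite im_opensK.
    by exists (res WU) => s; rewrite res_res res_id.
  have fWV : preim_opens (mor_cont f) W `<=` preim_opens (mor_cont f) V.
    by rewrite im_opensK.
  apply: (localization_iso (phi := res WV \o phi) (psi := res UV \o (comor f V \o phi))
    (h := res UW \o comor f W)) (loc a W WV WE).
    exact: bij_comp res_bij (f_bij W).
  by move=> x; rewrite /= (comor_res WV fWV) res_res; apply: res_irr.
Qed.

Lemma scheme_iso : scheme Y -> scheme X.
Proof.
move=> schY x; have [V [Vx aff]] := schY (f x).
by exists (preim_opens (mor_cont f) V); split=> //; apply: affine_iso.
Qed.
End SchemeIso.

Lemma flat_over_iso (R : comPzRingType) (X Y : ringed_space_over R) (f : morphism X Y) :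
  homeomorphism f -> (forall V : opens Y, bijective (comor f V)) -> over_base f ->
  flat_over Y -> flat_over X.
Proof.
move=> f_homeo f_bij f_over flat x.
apply: (flat_hom_iso (stalk_map_bij f_homeo f_bij x) _ (flat (f x))) => r /=.
by rewrite stalk_mapE f_over; apply: germ_res.
Qed.

Section CanonicalIsLifting.
Variables (p : nat) (p_pr : prime p) (k : fieldType) (k_char : p \in [pchar k]).
Variables (X : ringed_space_over k) (sigma : frobenius_splitting p X).
Local Notation C := (canonical_lifting p_pr k_char sigma).

(** A class (0, f_1) equals p (sigma(f_1), 0), as (0, f_1) and (0, sigma(f_1) ^ p)
    have the same class. *)
Lemma cl_pi_kernel (U : opens X) (a : witt2 p_pr (sec U)) : w0 a = 0 ->
  cl_pi k_char sigma a = cl_pi k_char sigma (Witt2 p_pr (sigma U (w1 a)) 0) *+ p.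
Proof.
move=> a0; rewrite -rmorphMn; apply/cl_piP.
by rewrite witt2_mulrnp ?(sec_pnat k_char) //= fs_split.
Qed.

Lemma canonical_closed_fibre : closed_fibre C.
Proof.
have embE x (V : opens X) (Vx : V x) a :
    @germ X x (preim_opens (mor_cont (th_emb C)) V) Vx
      (comor (th_emb C) V (cl_pi k_char sigma a)) = germ Vx (w0 a).
  apply: etrans (congr1 (@germ X x (preim_opens (@id_cont X) V) Vx)
    (cl_emb_comorE k_char sigma a)) _.
  exact: germ_res.
split=> [|Z oZ|x U Ux s|x V Vx t].
- by split=> [x _|x y _ _|x _] //; exists x.
- by rewrite image_id.
- by exists U, Ux, (cl_pi k_char sigma (Witt2 p_pr s 0)); rewrite embE.
have [a ->] := cl_pi_surj t; rewrite embE => /germ0P[W [WV [Wx a0]]].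
(* On W the class is p times that of (sigma(f_1), 0), and p lies in the kernel of
   W_2(k) -> k. *)
exists [:: (p%:R, @germ C x W Wx (cl_pi k_char sigma (Witt2 p_pr (sigma W (res WV (w1 a))) 0)))].
split=> [y|].
  rewrite inE => /eqP -> /=; rewrite witt2_w0_nat; exact: pcharf0 k_char.
rewrite big_seq1 /= !rmorph_nat mulr_natl -rmorphMn.
rewrite -(cl_pi_kernel (a := witt2_map p_pr (res WV) a)) //.
rewrite -(germ_res (X := C) WV Wx); congr germ; exact: cl_resE.
Qed.
End CanonicalIsLifting.

Theorem theorem2 (p : nat) (p_pr : prime p) (k : fieldType)
    (k_char : p \in [pchar k]) (k_perfect : forall a : k, exists b : k, b ^+ p = a) :
  (forall (X : k_scheme k) (L : frobenius_lifting p_pr k_char X)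
      (sigma : frobenius_splitting p X),
     is_lifting (canonical_lifting p_pr k_char sigma)) /\
  exists iota : forall (X : k_scheme k) (L : frobenius_lifting p_pr k_char X)
      (sigma : frobenius_splitting p X),
      lifting_iso (canonical_lifting p_pr k_char sigma) L,
    forall (X Y : k_scheme k)
      (LX : frobenius_lifting p_pr k_char X) (sigmaX : frobenius_splitting p X)
      (LY : frobenius_lifting p_pr k_char Y) (sigmaY : frobenius_splitting p Y)
      (f : frobenius_map LX sigmaX LY sigmaY),
      mor_eq (mor_comp (iota Y LY sigmaY) (canonical_map p_pr k_char (fm_split f)))
             (mor_comp (fm_lift f) (iota X LX sigmaX)).
Proof.
split=> [X L sigma|].
  have [sch flat _] := fl_is_lifting L.
  have homeo := comparison_homeo k_perfect L sigma.
  have bij := @comparison_bij p p_pr k k_char k_perfect X L sigma.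
  split; [exact: scheme_iso homeo bij sch | | exact: canonical_closed_fibre].
  exact: flat_over_iso homeo bij (comparison_over k_perfect L sigma) flat.
exists (fun X L sigma => sval (comparison_iso k_perfect L sigma)).
move=> X Y LX sigmaX LY sigmaY f.
rewrite (svalP (comparison_iso k_perfect LY sigmaY)) (svalP (comparison_iso k_perfect LX sigmaX)).
exact: comparison_natural.
Qed.
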